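(* Let $V$ be a variety of semigroups. The following conditions are equivalent. (1) Every semigroup in $V$ is cyclically regular. (2) For some positive integer $n$, the identities $x^{2}=x^{n+2}$ and $xyx=(xy)^{n+1}x$ hold in $V$. (3) $V$ contains none of the finite semigroups $A$, $B$, $C_{\lambda}$, $C_{\rho}$, $N_{3}$, $D$, and $K_{n}$ ($n=1,2,3,\dots$).
   Context: An element $b$ of a semigroup $S$ is regular if $b=bsb$ for some $s\in S$. An element $b\in S$ is called cyclic if $b=axa$ for some $a\in S$ and $x\in S^{1}$, where $S^1$ is $S$ with an identity element adjoined if necessary. A semigroup is called cyclically regular if each of its cyclic elements is regular. The following semigroups are given by generators and defining relations in the class of semigroups with zero $0$: $A=\langle x,y \mid x=x^{2},\ y^{2}=0,\ xy=yx\rangle$; $B=\langle x,y \mid x^{2}=0,\ y^{2}=0,\ xyx=yxy\rangle$; $C_{\lambda}=\langle x,y \mid x^{2}=x^{3},\ xy=y,\ yx^{2}=0,\ y^{2}=0\rangle$; $C_{\rho}=\langle x,y \mid x^{2}=x^{3},\ yx=y,\ x^{2}y=0,\ y^{2}=0\rangle$; $N_{3}=\langle x \mid x^{3}=0\rangle$; $D=\langle x,y \mid x^{2}=0,\ y=y^{2},\ yxy=0\rangle$; and, for each positive integer $n$, $K_{n}=\langle x,y \mid x^{2}=0,\ y^{2}=y^{n+2},\ yxy=0,\ xy^{q}x=0\ (q=2,\dots,n),\ xyx=xy^{n+1}x\rangle$. *)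

(* Defs.v *)
From HB Require Import structures.
From mathcomp Require Import all_boot.
From mathcomp Require Import boolp.

Set Implicit Arguments.
Unset Strict Implicit.
Unset Printing Implicit Defensive.

Local Open Scope group_scope.
Local Open Scope quotient_scope.

(* The power [x ^^ n] is only meaningful for [n >= 1]: a semigroup need not
   have an identity element. *)
Definition spow (S : semigroupType) (x : S) (n : nat) : S := iterop n mul x x.

Notation "x ^^ n" := (spow x n) (at level 29, left associativity) : group_scope.

Definition regular (S : semigroupType) (b : S) : Prop :=
  exists s : S, b = b * s * b.

(* [b = a * x * a] with [x] in the monoid [S^1]; the first disjunct is [x = 1]. *)
Definition cyclic_elt (S : semigroupType) (b : S) : Prop :=
  exists a : S, b = a * a \/ exists x : S, b = a * x * a.

Definition cyclically_regular (S : semigroupType) : Prop :=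
  forall b : S, cyclic_elt b -> regular b.

(* [P], with projections [p], is a direct product of the family [F]. *)
Definition direct_product (I : Type) (F : I -> semigroupType)
    (P : semigroupType) (p : forall i, {multiplicative P -> F i}) : Prop :=
  forall x : (forall i, F i), exists! a : P, forall i, p i a = x i.

(* Semigroups are nonempty, which [semigroupType] does not require; hence the
   [inhabited] conditions.  Since [S] embeds in [T] iff it is isomorphic to a
   subsemigroup of [T], the second closure condition is closure under
   subsemigroups (and isomorphism).  The empty product is included in the third,
   so a variety contains the one-element semigroups. *)
Record variety (V : semigroupType -> Prop) : Prop := Variety {
  variety_nonempty : forall S : semigroupType, V S -> inhabited S;
  variety_image : forall (S T : semigroupType) (f : {multiplicative S -> T}),
    V S -> (forall y : T, exists x : S, f x = y) -> V T;
  variety_sub : forall (S T : semigroupType) (f : {multiplicative S -> T}),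
    inhabited S -> V T -> injective f -> V S;
  variety_product : forall (I : Type) (F : I -> semigroupType)
    (P : semigroupType) (p : forall i, {multiplicative P -> F i}),
    (forall i, V (F i)) -> direct_product p -> V P }.

(* The free semigroup with zero on [X]: [None] is the zero and [Some (a, w)] is
   the nonempty word [a :: w]. *)
Definition free0 (X : choiceType) : Type := option (X * seq X).

HB.instance Definition _ (X : choiceType) :=
  Choice.copy (free0 X) (option (X * seq X)).

Section Free0.
Variable X : choiceType.

Definition zero0 : free0 X := None.
Definition gen0 (a : X) : free0 X := Some (a, [::]).

Definition mul0 (u v : free0 X) : free0 X :=
  match u, v with
  | Some (a, s), Some (b, t) => Some (a, s ++ b :: t)
  | _, _ => None
  end.

Lemma mul0A : associative mul0.
Proof. by move=> [[a s]|] [[b t]|] [[c r]|] //=; rewrite -catA. Qed.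

HB.instance Definition _ := isSemigroup.Build (free0 X) mul0A.

End Free0.

Section Presentation.
Variables (X : choiceType) (R : seq (free0 X * free0 X)).

Inductive congruence : free0 X -> free0 X -> Prop :=
| cong_rel u v : (u, v) \in R -> congruence u v
| cong_refl u : congruence u u
| cong_sym u v : congruence u v -> congruence v u
| cong_trans u v w : congruence u v -> congruence v w -> congruence u w
| cong_mul u u' v v' :
    congruence u u' -> congruence v v' -> congruence (u * v) (u' * v').

Definition congb : rel (free0 X) := fun u v => `[< congruence u v >].

Lemma congb_refl : reflexive congb.
Proof. by move=> u; apply/asboolP; apply: cong_refl. Qed.

Lemma congb_sym : symmetric congb.
Proof. by move=> u v; apply/asboolP/asboolP; apply: cong_sym. Qed.

Lemma congb_trans : transitive congb.
Proof.
move=> v u w /asboolP uv /asboolP vw; apply/asboolP; exact: cong_trans uv vw.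
Qed.

Canonical congb_equiv := EquivRel congb congb_refl congb_sym congb_trans.

(* The semigroup with zero generated by [X] subject to the relations [R]. *)
Definition presented : Type := {eq_quot congb_equiv}.

HB.instance Definition _ := Choice.copy presented {eq_quot congb_equiv}.
HB.instance Definition _ := EqQuotient.on presented.

Lemma presentedP (u v : free0 X) :
  \pi_presented u = \pi_presented v <-> congruence u v.
Proof. by split=> [/eqmodP/asboolP|uv] //; apply/eqmodP/asboolP. Qed.

Definition presented_mul := lift_op2 presented (fun u v : free0 X => u * v).

Lemma presented_mul_pi :
  {morph \pi_presented : u v / u * v >-> presented_mul u v}.
Proof.
move=> u v; unlock presented_mul; apply/presentedP/cong_mul; apply/presentedP;
  by rewrite reprK.
Qed.

Lemma presented_mulA : associative presented_mul.
Proof.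
elim/quotW=> a; elim/quotW=> b; elim/quotW=> c.
by rewrite -!presented_mul_pi mulgA.
Qed.

HB.instance Definition _ := isSemigroup.Build presented presented_mulA.

End Presentation.

Section Semigroups.

Let x : free0 bool := gen0 false.
Let y : free0 bool := gen0 true.
Let o : free0 bool := zero0 bool.

Definition semigroupA : semigroupType :=
  presented [:: (x, x ^^ 2); (y ^^ 2, o); (x * y, y * x)].

Definition semigroupB : semigroupType :=
  presented [:: (x ^^ 2, o); (y ^^ 2, o); (x * y * x, y * x * y)].

Definition semigroupC_lambda : semigroupType :=
  presented [:: (x ^^ 2, x ^^ 3); (x * y, y); (y * x ^^ 2, o); (y ^^ 2, o)].

Definition semigroupC_rho : semigroupType :=
  presented [:: (x ^^ 2, x ^^ 3); (y * x, y); (x ^^ 2 * y, o); (y ^^ 2, o)].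

Definition semigroupN3 : semigroupType :=
  presented [:: (gen0 tt ^^ 3, zero0 unit)].

Definition semigroupD : semigroupType :=
  presented [:: (x ^^ 2, o); (y, y ^^ 2); (y * x * y, o)].

(* [iota 2 n.-1] lists [q = 2, ..., n]; only [n >= 1] is meant. *)
Definition semigroupK (n : nat) : semigroupType :=
  presented ([:: (x ^^ 2, o); (y ^^ 2, y ^^ (n + 2)); (y * x * y, o);
                 (x * y * x, x * y ^^ (n + 1) * x)]
             ++ [seq (x * y ^^ q * x, o) | q <- iota 2 n.-1]).

End Semigroups.

(* Main.v *)
(* Write [a <=J b] when [a = p * b * q] with [p], [q] in S^1.  Excluding N_3 gives
   [x^2 = x^(n+2)] with a least period [n]; excluding A makes every [e S e], [e]
   idempotent, completely regular; excluding C_lambda and C_rho turns [xyx <=J x^2 y x]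
   and [xyx <=J x y x^2] into [xyx <=J x^2 y x^2], hence into [xyx <=J (xy)^2], which is
   the second identity of (2).  So that identity follows as soon as [xyx] equals a word
   properly containing [xyx].  Excluding B provides an identity [xyx = w] with [w]
   different from [xyx] and [yxy]; substituting it into itself leads to such a word
   unless [w = x y^c x], and then [xyx = x y^(n+1) x] because [n] divides [c - 1].  In
   this last case the identity that fails in K_n finishes the proof.

   None of the listed semigroups is cyclically regular: [xyx] ([x^2] in N_3) is nonzero
   but [xyx s xyx = 0] for all [s]. *)
From HB Require Import structures.
Require Import Defs.
From mathcomp Require Import all_boot zify.
From mathcomp Require Import boolp.

Set Implicit Arguments.
Unset Strict Implicit.
Unset Printing Implicit Defensive.

Local Open Scope group_scope.

(** Excluding a semigroup given by a presentation yields more than an identity that fails there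
    under some substitution: [separating_identity] gives an identity of V between two words in the
    generators that already represent different elements of the presented semigroup. Such identities
    can be classified by normal forms in A, B, C_lambda, C_rho and K_n, and they involve at most two
    letters.

    The period has to be the least one because it then divides the difference of the lengths of the
    two sides of every identity of V. This controls exponents of y modulo n, which is all that K_n
    sees of the powers of y beyond the first.

    A divisibility is turned into an equation by iteration: from xyx = p (xyx) q follows xyx = p^k
    (xyx) q^k. An idempotent power of q, or of p, is then absorbed, and the factor on the other side
    disappears.

    The computations take place in S^1, where outer factors and zeroth powers may be trivial, while
    only elements of S are substituted for letters. *)

Section Division.
Variable M : monoidType.
Implicit Types a b c p q : M.

Definition divides_by a b := exists p q : M, a = p * b * q.

Lemma divides_by_trans b a c : divides_by a b -> divides_by b c -> divides_by a c.
Proof. by move=> [p [q ->]] [r [s ->]]; exists (p * r), (s * q); rewrite !mulgA. Qed.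

Lemma sandwich_iter p q a k : a = p * a * q -> a = p ^+ k * a * q ^+ k.
Proof.
move=> E; elim: k => [|k IH]; first by rewrite !expg0 mul1g mulg1.
by rewrite expgSr expgS {1}IH {1}E !mulgA.
Qed.

Lemma expg_shift a b k : a * (b * a) ^+ k = (a * b) ^+ k * a.
Proof.
elim: k => [|k IH]; first by rewrite !expg0 mulg1 mul1g.
by rewrite expgSr mulgA IH expgSr !mulgA.
Qed.

End Division.

Local Infix "<=J" := divides_by (at level 70).

(** * Evaluation of two-letter words *)

Section Words.
Variable M : monoidType.
Implicit Types x y : M.

Definition ev x y (w : seq bool) : M := \prod_(b <- w) (if b then y else x).

Lemma ev0 x y : ev x y [::] = 1. Proof. exact: big_nil. Qed.

Lemma ev_cons x y b w : ev x y (b :: w) = (if b then y else x) * ev x y w.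
Proof. exact: big_cons. Qed.

Lemma ev_cat x y u v : ev x y (u ++ v) = ev x y u * ev x y v.
Proof. exact: big_cat. Qed.

Lemma ev_nseq x y k b : ev x y (nseq k b) = (if b then y else x) ^+ k.
Proof. by elim: k => [|k IH]; rewrite ?ev0 // ev_cons IH expgS. Qed.

Definition evE := (ev_cat, ev_nseq, ev_cons, ev0).

Lemma ev_swap x y w : ev y x w = ev x y (map negb w).
Proof. by rewrite /ev big_map; apply: eq_bigr => -[]. Qed.

Lemma ev_diag x w : ev x x w = x ^+ size w.
Proof. by elim: w => [|b w IH]; rewrite !evE // IH; case: b; rewrite -expgS. Qed.

End Words.

(** * From divisibility to the second identity, in the presence of a period *)

(* [M] is the monoid S^1 and [P] its ideal S. *)
Section Core.
Variables (M : monoidType) (P : M -> Prop) (n : nat).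
Hypotheses (PMl : forall a b, P a -> P (a * b)) (PMr : forall a b, P b -> P (a * b)).
Hypothesis n_gt0 : 0 < n.
Hypothesis sq : forall x, P x -> x ^+ 2 = x ^+ (n + 2).

Definition collapse := forall x y, P x -> P y -> x * y * x = (x * y) ^+ n.+1 * x.

Lemma expg_period x k j : P x -> 1 < k -> x ^+ (k + j * n) = x ^+ k.
Proof.
move=> Px k2; elim: j => [|j IH]; first by rewrite mul0n addn0.
rewrite mulSn (_ : k + (n + j * n) = (k - 2 + j * n) + (n + 2))%N; last lia.
rewrite expgnDr -sq // -expgnDr -IH; congr (_ ^+ _); lia.
Qed.

Lemma expg_eqmod x k l : P x -> 1 < k -> 1 < l -> k = l %[mod n] -> x ^+ k = x ^+ l.
Proof.
move=> Px; wlog kl : k l / k <= l.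
  by move=> H k1 l1 E; case/orP: (leq_total k l) => ?; [|symmetry]; exact: H.
move=> k1 l1 /eqP; rewrite eq_sym eqn_mod_dvd // => /dvdnP[j E].
by rewrite -(subnKC kl) E expg_period.
Qed.

Lemma power_regular a r : P a -> a = a ^+ r.+2 -> a = a ^+ n.+1.
Proof.
move=> Pa E; have {E} E k : a = a ^+ (1 + k * r.+1).
  elim: k => // k IH; rewrite mulSn addnCA addnC.
  by rewrite expgnDr -IH -expgS.
rewrite {1}(E n); apply: expg_eqmod; rewrite ?ltnS ?muln_gt0 ?n_gt0 //.
by rewrite mulnC addnC modnMDl -[n.+1]addn1 modnDl.
Qed.

(** The exponent is 2n rather than n because the period says nothing about first powers: for n = 1
    the element x itself need not be idempotent. *)
Definition idp x : M := x ^+ n.*2.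

Lemma idp_idem x : P x -> idp x * idp x = idp x.
Proof. by move=> Px; rewrite /idp -expgnDr -{2}muln2 [(n * 2)%N]mulnC expg_period //; lia. Qed.

Lemma idpE x : idp x = x * x ^+ n.*2.-1.
Proof. by rewrite -expgS prednK // double_gt0. Qed.

Lemma idpEr x : idp x = x ^+ n.*2.-1 * x.
Proof. by rewrite -expgSr prednK // double_gt0. Qed.

Lemma P_idp x : P x -> P (idp x).
Proof. by move=> Px; rewrite idpE; exact: PMl. Qed.

Lemma sq_idp x : P x -> x ^+ 2 = idp x * x ^+ 2.
Proof.
by move=> Px; rewrite /idp -expgnDr addnC -muln2 [(n * 2)%N]mulnC expg_period.
Qed.

Lemma sq_idpr x : P x -> x ^+ 2 = x ^+ 2 * idp x.
Proof. by move=> Px; rewrite /idp -expgnDr -muln2 [(n * 2)%N]mulnC expg_period. Qed.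

Lemma sq_pow x : P x -> x ^+ 2 = x ^+ n * x ^+ 2.
Proof. by move=> Px; rewrite -expgnDr -sq. Qed.

Lemma sq_powr x : P x -> x ^+ 2 = x ^+ 2 * x ^+ n.
Proof. by move=> Px; rewrite -expgnDr addnC -sq. Qed.

(** After 2n iterations the right-hand factor is an idempotent power of q, so multiplying by it once
    more changes nothing. *)
Lemma absorb_right p a q : P q -> a = p * a * q -> a = a * idp q.
Proof.
move=> Pq /(sandwich_iter n.*2) E.
by rewrite {2}E -mulgA -/(idp q) idp_idem // /idp -E.
Qed.

Lemma absorb_left p a q : P p -> a = p * a * q -> a = idp p * a.
Proof.
move=> Pp /(sandwich_iter n.*2) E.
by rewrite {2}E !mulgA -/(idp p) idp_idem // /idp -E.
Qed.

(** Writing xyx = p (xyx) (yq) and absorbing yq on the right shows that xyx begins with (xy)^2,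
    which is fixed by left multiplication with (xy)^n. *)
Lemma collapse_xyxy :
  (forall x y, P x -> P y -> x * y * x <=J x * y * x * y) -> collapse.
Proof.
move=> H x y Px Py; have [p [q E]] := H x y Px Py.
have E1 : x * y * x = p * (x * y * x) * (y * q) by rewrite {1}E !mulgA.
have := absorb_right (PMl q Py) E1; rewrite idpE => E2.
have E3 : x * y * x = (x * y) ^+ 2 * (q * (y * q) ^+ n.*2.-1).
  by rewrite {1}E2 expg2 !mulgA.
have Pxy : P (x * y) by exact: PMl.
by rewrite expgSr -(mulgA _ (x * y) x) E3 [RHS]mulgA -sq_pow.
Qed.

Lemma collapse_yxyx :
  (forall x y, P x -> P y -> x * y * x <=J y * x * y * x) -> collapse.
Proof.
move=> H x y Px Py; have [p [q E]] := H x y Px Py.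
have E1 : x * y * x = (p * y) * (x * y * x) * q by rewrite {1}E !mulgA.
have := absorb_left (PMr p Py) E1; rewrite idpEr => E2.
have E3 : x * y * x = ((p * y) ^+ n.*2.-1 * p) * (y * x) ^+ 2.
  by rewrite {1}E2 expg2 !mulgA.
have Pyx : P (y * x) by exact: PMl.
by rewrite -expg_shift expgS !mulgA E3 -[RHS]mulgA -sq_powr.
Qed.

(* What the exclusion of A gives; the two hypotheses [shift_left] and [shift_right] below
   are what remains of the exclusion of C_lambda and C_rho. *)
Hypothesis local_regular : forall e a, P e -> e * e = e -> P a ->
  e * a * e = (e * a * e) ^+ n.+1.

Lemma local_sq e a : P e -> e * e = e -> P a ->
  e * a * e <=J e * a * e * a * e.
Proof.
move=> Pe ee Pa; rewrite {1}local_regular //.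
exists 1, ((e * a * e) ^+ n.-1); rewrite mul1g.
have -> : n.+1 = (2 + n.-1)%N by lia.
by rewrite expgnDr expg2 !mulgA -(mulgA _ e e) ee.
Qed.

Lemma collapse_x2yx2 :
  (forall x y, P x -> P y -> x * y * x <=J x ^+ 2 * y * x ^+ 2) -> collapse.
Proof.
move=> H; apply: collapse_xyxy => x y Px Py.
have Pxy : P (x * y) by exact: PMl.
have Pe := P_idp Px; have ee := idp_idem Px.
apply: divides_by_trans (H x y Px Py) _.
(* With e the idempotent power of x and u = xy:
   x^2 y x^2 <=J e u e <=J u e u <=J u^2 e u^2. *)
apply: (divides_by_trans (b := idp x * (x * y) * idp x)).
  have E : x ^+ 2 = x * (idp x * x).
    by rewrite /idp -expgSr -expgS (_ : n.*2.+2 = 2 + 2 * n)%N ?expg_period //; lia.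
  by exists x, (x ^+ 2); rewrite {1}E {1}sq_idp // !mulgA.
apply: divides_by_trans (local_sq Pe ee Pxy) _.
apply: (divides_by_trans (b := x * y * idp x * (x * y))).
  by exists (idp x), (idp x); rewrite !mulgA.
apply: divides_by_trans (H _ _ Pxy Pe) _.
by exists ((x * y) ^+ 2 * idp x), 1; rewrite !expg2 !mulgA mulg1.
Qed.

Hypothesis shift_left : exists N, forall x y, P x -> P y ->
  x ^+ N * y * x <=J x ^+ 2 * y * x ^+ 2.
Hypothesis shift_right : exists N, forall x y, P x -> P y ->
  x * y * x ^+ N <=J x ^+ 2 * y * x ^+ 2.

Lemma sq_high x N : P x -> exists m, x ^+ 2 = m * x ^+ N /\ x ^+ 2 = x ^+ N * m.
Proof.
move=> Px; exists (x ^+ (2 + N * n - N)); rewrite -!expgnDr.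
have ? : N <= N * n by rewrite leq_pmulr.
by rewrite subnK ?subnKC ?expg_period //; lia.
Qed.

(** Absorbing px on the left frees xyx from its right-hand factor, so xyx = r x^2 y x for some r.
    Since x^2 is divisible by every power x^N, the factor x^N y x appears, and [shift_left] applies
    to it. *)
Lemma collapse_x2yx :
  (forall x y, P x -> P y -> x * y * x <=J x ^+ 2 * y * x) -> collapse.
Proof.
case: shift_left => N HN H; apply: collapse_x2yx2 => x y Px Py.
apply: divides_by_trans (HN x y Px Py).
have [p [q E]] := H x y Px Py.
have E1 : x * y * x = (p * x) * (x * y * x) * q by rewrite {1}E expg2 !mulgA.
have := absorb_left (PMr p Px) E1; rewrite idpEr => E2.
have [m [E3 _]] := sq_high N Px.
exists ((p * x) ^+ n.*2.-1 * p * m), 1; rewrite mulg1 {1}E2.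
have -> : (p * x) ^+ n.*2.-1 * (p * x) * (x * y * x)
  = (p * x) ^+ n.*2.-1 * p * x ^+ 2 * y * x by rewrite expg2 !mulgA.
by rewrite E3 !mulgA.
Qed.

Lemma collapse_xyx2 :
  (forall x y, P x -> P y -> x * y * x <=J x * y * x ^+ 2) -> collapse.
Proof.
case: shift_right => N HN H; apply: collapse_x2yx2 => x y Px Py.
apply: divides_by_trans (HN x y Px Py).
have [p [q E]] := H x y Px Py.
have E1 : x * y * x = p * (x * y * x) * (x * q) by rewrite {1}E expg2 !mulgA.
have := absorb_right (PMl q Px) E1; rewrite idpE => E2.
have [m [_ E3]] := sq_high N Px.
exists 1, (m * (q * (x * q) ^+ n.*2.-1)); rewrite mul1g {1}E2.
have -> : x * y * x * (x * q * (x * q) ^+ n.*2.-1)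
  = x * y * x ^+ 2 * (q * (x * q) ^+ n.*2.-1) by rewrite expg2 !mulgA.
by rewrite E3 !mulgA.
Qed.

(** * Identities with left-hand side xyx *)

Definition holds u v := forall x y : M, P x -> P y -> ev x y u = ev x y v.

Let xyx := [:: false; true; false].
Let yxy := [:: true; false; true].

Lemma ev_xyx (x y : M) : ev x y xyx = x * y * x.
Proof. by rewrite !evE mulg1 mulgA. Qed.

Lemma ev_sandwich (x y : M) p q :
  ev x y (p ++ xyx ++ q) = ev x y p * ev x y xyx * ev x y q.
Proof. by rewrite !ev_cat mulgA. Qed.

(** A letter adjacent to the inner xyx extends it to yxyx, x^2 yx, xyxy or xyx^2, which are the four
    divisibilities treated above. *)
Lemma collapse_word p q : p ++ q != [::] -> holds xyx (p ++ xyx ++ q) -> collapse.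
Proof.
move=> pq0 H.
have {}H x y : P x -> P y -> x * y * x = ev x y p * (x * y * x) * ev x y q.
  by move=> Px Py; rewrite -{1}ev_xyx H // !ev_cat ev_xyx !mulgA.
case/lastP: p pq0 H => [|p b] pq0 H; last first.
  case: b H {pq0} => H; [apply: collapse_yxyx|apply: collapse_x2yx] => x y Px Py;
    exists (ev x y p), (ev x y q); rewrite {1}H // -cats1 !evE mulg1 ?expg2 !mulgA //.
case: q pq0 H => // b q _ H.
case: b H => H; [apply: collapse_xyxy|apply: collapse_xyx2] => x y Px Py;
    exists 1, (ev x y q); rewrite {1}H // !evE ?expg2 !mulgA !mul1g //.
Qed.

(** An element that begins with z^2 is unchanged by the prefix z^n, so xyx = z^n xyx, and n is
    positive. *)
Lemma collapse_pre_sq b :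
  (forall x y, P x -> P y -> exists m, x * y * x = (if b then y else x) ^+ 2 * m) ->
  collapse.
Proof.
move=> H; apply: (@collapse_word (nseq n b) [::]).
  by rewrite cats0; case: (n) n_gt0.
move=> x y Px Py; rewrite cats0 ev_cat ev_nseq ev_xyx.
have [m ->] := H x y Px Py.
by rewrite mulgA -sq_pow //; case: (b).
Qed.

Lemma collapse_post_sq b :
  (forall x y, P x -> P y -> exists m, x * y * x = m * (if b then y else x) ^+ 2) ->
  collapse.
Proof.
move=> H; apply: (@collapse_word [::] (nseq n b)).
  by case: (n) n_gt0.
move=> x y Px Py; rewrite cat0s ev_cat ev_nseq ev_xyx.
have [m ->] := H x y Px Py.
by rewrite -mulgA -sq_powr //; case: (b).
Qed.

Lemma run (b : bool) s : exists d t, s = nseq d b ++ t /\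
  (t = [::] \/ exists t', t = ~~ b :: t').
Proof.
elim: s => [|c s [d [t [-> H]]]]; first by exists 0, [::]; split; [|left].
have [->|/negPf cb] := eqVneq c b; first by exists d.+1, t.
exists 0, (c :: nseq d b ++ t); split=> //; right; exists (nseq d b ++ t).
by case: c b cb {H} => -[].
Qed.

Lemma run_rev (b : bool) s : exists d t, s = t ++ nseq d b /\
  (t = [::] \/ exists t', t = rcons t' (~~ b)).
Proof.
have [d [t [E H]]] := run b (rev s); exists d, (rev t); split.
  by rewrite -[s]revK E rev_cat rev_nseq.
by case: H => [->|[t' ->]]; [left|right; exists (rev t'); rewrite rev_cons].
Qed.

Lemma collapse_start_y s : holds xyx (true :: s) -> true :: s != yxy -> collapse.
Proof.
have [[|d] [t [-> []]]] := run false s.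
- move=> -> H _; apply: (@collapse_word [:: false] [:: false]) => // x y Px Py.
  rewrite [RHS]ev_sandwich H // !evE !mulg1.
  by have := H x y Px Py; rewrite !evE !mulg1 !mulgA => ->.
- move=> [t' ->] H _; apply: (@collapse_pre_sq true) => x y Px Py.
  by exists (ev x y t'); rewrite -ev_xyx H // !evE /= expg2 mul1g mulgA.
- case: d => [|d] -> H _.
    apply: (@collapse_word [:: false] [::]) => // x y Px Py.
    rewrite [RHS]ev_sandwich H // !evE !mulg1.
    by have := H x y Px Py; rewrite !evE !mulg1 !mulgA => ->.
  apply: (@collapse_post_sq false) => x y Px Py.
  exists (y * x ^+ d); rewrite -ev_xyx H //.
  by rewrite !evE mulg1 -mulgA -expgnDr addnC.
(* The word is [y z y t'] with [z = x^(d+1)], and [y z y] is in turn an instance of the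
   left-hand side of the identity. *)
move=> [t' ->]; set Z := nseq _ _ => H ne.
have E x y : P x -> P y -> x * y * x =
    x ^+ d.+1 * y ^+ d.+1 * x ^+ d.+1 * ev y (x ^+ d.+1) t' * ev x y t'.
  move=> Px Py; have Pz : P (x ^+ d.+1) by rewrite expgS; apply: PMl.
  rewrite -ev_xyx H // !evE /= !mulgA.
  by have := H _ _ Py Pz; rewrite ev_xyx !evE /= !mulgA => ->.
(* For an x-block of length one the identity becomes xyx = xyx t'(y,x) t'(x,y), where t' is nonempty
   because the word is not yxy. For a longer block the new right-hand side begins with x^2. *)
case: d @Z H E ne => [|d] Z H E ne.
  apply: (@collapse_word [::] (map negb t' ++ t')) => [|x y Px Py].
    by case: t' {H E} ne.
  by rewrite cat0s ev_xyx E // !expg1 (ev_cat _ _ xyx) ev_xyx ev_cat -ev_swap !mulgA.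
apply: (@collapse_pre_sq false) => x y Px Py; rewrite E //.
exists (x ^+ d * y ^+ d.+2 * x ^+ d.+2 * ev y (x ^+ d.+2) t' * ev x y t').
by rewrite !mulgA -expgnDr.
Qed.

(** This is the left-right mirror image of [collapse_start_y]. *)
Lemma collapse_end_y s : holds xyx (rcons s true) -> rcons s true != yxy -> collapse.
Proof.
have [[|d] [t [-> []]]] := run_rev false s.
- move=> -> H _; apply: (@collapse_word [:: false] [:: false]) => // x y Px Py.
  rewrite [RHS]ev_sandwich H // !evE !mulg1.
  by have := H x y Px Py; rewrite !evE !mulg1 !mulgA => ->.
- move=> [t' ->] H _; apply: (@collapse_post_sq true) => x y Px Py.
  by exists (ev x y t'); rewrite -ev_xyx H // cats0 -!cats1 !evE !mulg1 /= expg2 mulgA.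
- case: d => [|d] -> H _.
    apply: (@collapse_word [::] [:: false]) => // x y Px Py.
    rewrite [RHS]ev_sandwich H // !evE !mul1g !mulg1.
    by have := H x y Px Py; rewrite !evE !mulg1 !mulgA => ->.
  apply: (@collapse_pre_sq false) => x y Px Py.
  exists (x ^+ d * y); rewrite -ev_xyx H //.
  by rewrite -cats1 !evE mulg1 mul1g mulgA -expgnDr.
move=> [t' ->]; rewrite -!cats1; set Z := nseq _ _ => H ne.
have E x y : P x -> P y -> x * y * x =
    ev x y t' * ev y (x ^+ d.+1) t' * x ^+ d.+1 * y ^+ d.+1 * x ^+ d.+1.
  move=> Px Py; have Pz : P (x ^+ d.+1) by rewrite expgS; apply: PMl.
  rewrite -ev_xyx H // !evE /= !mulg1 -!mulgA; congr (_ * _).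
  by have := H _ _ Py Pz; rewrite ev_xyx !evE /= !mulg1 -!mulgA.
case: d @Z H E ne => [|d] Z H E ne.
  apply: (@collapse_word (t' ++ map negb t') [::]) => [|x y Px Py].
    by case: t' {H E} ne.
  by rewrite ev_sandwich ev_xyx {1}E // !expg1 ev_cat -ev_swap !evE mulg1 !mulgA.
apply: (@collapse_post_sq false) => x y Px Py; rewrite E //.
exists (ev x y t' * ev y (x ^+ d.+2) t' * x ^+ d.+2 * y ^+ d.+2 * x ^+ d).
by rewrite -[RHS]mulgA -expgnDr addnC.
Qed.

(* A block of at least two [y] does not see the substitution of [y^(n+1)] for [y]. *)
Lemma ev_long_blocks s x y : P x -> P y ->
  (~~ infix xyx (false :: rcons s false) ->
     ev x y (false :: rcons s false) = ev x (y ^+ n.+1) (false :: rcons s false)) /\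
  (~~ infix xyx (rcons s false) ->
     y ^+ 2 * ev x y (rcons s false)
     = (y ^+ n.+1) ^+ 2 * ev x (y ^+ n.+1) (rcons s false)).
Proof.
move=> Px Py.
have y2 : (y ^+ n.+1) ^+ 2 = y ^+ 2.
  by rewrite -expgnA (_ : n.+1 * 2 = 2 + 2 * n)%N ?expg_period //; lia.
have y3 : (y ^+ n.+1) ^+ 3 = y ^+ 3.
  by rewrite expgSr y2 -expgnDr (_ : 2 + n.+1 = 3 + 1 * n)%N ?expg_period //; lia.
(* The two claims feed each other: the first reads a word right after an x, the second continues
   inside a block of which y^2 has already been read. *)
elim: {s}_.+1 {-2}s (ltnSn (size s)) => // m IH s /ltnSE sm.
have noinfix b u : ~~ infix xyx (b :: u) -> ~~ infix xyx u.
  by apply: contraNN => I; exact: (infix_catl [:: b] I).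
case: s sm => [|[] s] sm.
- by split=> _; rewrite !evE // y2.
- split.
    case: s sm => [|[] s] sm; rewrite ?rcons_cons; try by rewrite /= ?prefix0s.
    move=> /noinfix /noinfix /noinfix NI.
    have [_ /(_ NI) E] := IH s (ltnW sm).
    by rewrite !ev_cons; congr (_ * _); rewrite !(mulgA _ _ (ev _ _ _)); exact: E.
  rewrite rcons_cons => /noinfix NI; have [_ /(_ NI) E] := IH s sm.
  rewrite !ev_cons /= !(mulgA _ _ (ev _ _ _)) -(expgSr (y ^+ n.+1)) y3.
  by rewrite -(expgSr y) expgS -mulgA E y2 mulgA -expgS.
rewrite rcons_cons; split=> [/noinfix NI|NI]; have [/(_ NI) E _] := IH s sm.
  by rewrite [LHS]ev_cons [RHS]ev_cons E.
by rewrite E y2.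
Qed.

(** The second hypothesis, applied again to y and x^(k+1), interchanges the letters and places
    y^(k+1) between squares of x. What remains is to bring the exponent of y back to 1. *)
Lemma collapse_long_blocks k :
  (forall x y, P x -> P y -> x * y * x = x * y ^+ n.+1 * x) ->
  (forall x y, P x -> P y -> x * y * x <=J y ^+ 2 * x ^+ k.+1 * y ^+ 2) ->
  collapse.
Proof.
move=> stretch H; apply: collapse_xyx2 => x y Px Py.
have PX z j : P z -> P (z ^+ j.+1) by rewrite expgS; exact: PMl.
have H1 : x * y * x <=J x ^+ 2 * y ^+ k.+1 * x ^+ 2.
  apply: divides_by_trans (H x y Px Py) _.
  apply: (divides_by_trans (b := y * x ^+ k.+1 * y)).
    by exists y, y; rewrite !expg2 !mulgA.
  apply: divides_by_trans (H _ _ Py (PX x k Px)) _.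
  have [Z1 Z2] : (x ^+ k.+1) ^+ 2 = x ^+ k.*2 * x ^+ 2
      /\ (x ^+ k.+1) ^+ 2 = x ^+ 2 * x ^+ k.*2.
    by rewrite -expgnA -!expgnDr; split; congr (_ ^+ _); lia.
  by exists (x ^+ k.*2), (x ^+ k.*2); rewrite {1}Z1 Z2 !mulgA.
(* With m = (k+1)(n+1):
   x^2 y^m x^2 <=J e y^m e <=J y^m e y^m <=J f e f <=J e y^(n+1) e <=J x (xyx) x,
   where the fourth step uses that f y is a unit of the completely regular monoid f M f. *)
pose e := idp x; pose f := idp y.
have [Pe Pf] : P e /\ P f by split; exact: P_idp.
have [ee ff] : e * e = e /\ f * f = f by split; exact: idp_idem.
(* [stretch] replaces y^(k+1) by y^m. As m > 1 even for k = 0, y^m is fixed by f, which y^(k+1) need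
   not be. *)
pose m := (k.+1 * n.+1)%N.
have m2 : 1 < m by rewrite /m; lia.
have ym : y ^+ m = y ^+ m * f /\ y ^+ m = f * y ^+ m.
  rewrite -!expgnDr -!muln2 [(n * 2)%N]mulnC expg_period // addnC.
  by rewrite expg_period.
have fy : f * y = y * f by rewrite /f /idp -expgS -expgSr.
have Pefy : P (e * f * y) by apply: PMr.
have Pm : P (y ^+ m) by rewrite -(ltn_predK m2); apply: PX.
apply: divides_by_trans H1 _.
apply: (divides_by_trans (b := e * y ^+ m * e)).
  exists (x * x), (x * x).
  have E : x ^+ 2 * y ^+ k.+1 * x ^+ 2 = x ^+ 2 * y ^+ m * x ^+ 2.
    rewrite !expg2 -!mulgA; congr (_ * _); rewrite !mulgA; congr (_ * _).
    by rewrite stretch ?expgnA //; apply: PX.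
  by rewrite E {1}[x ^+ 2]sq_idpr // {2}[x ^+ 2]sq_idp // expg2 !mulgA.
apply: divides_by_trans (local_sq Pe ee Pm) _.
apply: (divides_by_trans (b := f * e * f)).
  exists (e * y ^+ m), (y ^+ m * e); rewrite {1}(proj1 ym) {2}(proj2 ym).
  by rewrite !mulgA.
apply: (divides_by_trans (b := f * (e * f * y) * f)).
  exists 1, (y ^+ n.*2.-1); rewrite mul1g.
  have -> : f * (e * f * y) * f = f * e * (f * f) * y.
    by rewrite -!mulgA -fy !mulgA.
  by rewrite ff -!mulgA -idpE -/f ff.
apply: divides_by_trans (local_sq Pf ff Pefy) _.
apply: (divides_by_trans (b := e * (f * y * f) * e)).
  by exists f, (f * y * f); rewrite !mulgA.
have -> : f * y * f = y ^+ n.+1.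
  rewrite -mulgA -fy mulgA ff /f /idp -expgSr.
  by rewrite (_ : n.*2.+1 = n.+1 + 1 * n)%N ?expg_period //; lia.
exists (x ^+ n.*2.-1), (x ^+ n.*2.-2).
have -> : x * y * x ^+ 2 = x * y * x * x by rewrite expg2 mulgA.
have E : e = x * (x * x ^+ n.*2.-2).
  by rewrite -!expgS /e /idp; congr (_ ^+ _); lia.
by rewrite {1}/e idpEr {1}E stretch // !mulgA.
Qed.

(** Apart from very short words, what the previous lemmas leave begins and ends with x and avoids
    xyx, so every y-block has length at least two. If no x^2 stands at either end and there is more
    than one y-block, the first two blocks exhibit a factor y^2 x^(d+1) y^2. *)
Lemma collapse_ident w : holds xyx w -> w != yxy ->
  (forall c, w != false :: rcons (nseq c.+1 true) false) -> collapse.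
Proof.
move=> H neyxy nek.
have [/infixP[p [q E]]|NI] := boolP (infix xyx w).
  apply: (@collapse_word p q); last by rewrite -E.
  by apply: contra (nek 0); rewrite E; case: p {E} => //; case: q.
case: w H neyxy nek NI => [|[] s] H neyxy nek NI.
- apply: (@collapse_word [:: false; true] [:: false]) => // x y Px Py.
  by rewrite ev_sandwich H // !evE /= !mulg1 -(ev_xyx x y) H // ev0.
- exact: collapse_start_y H neyxy.
case/lastP: s H neyxy nek NI => [|s []] H neyxy nek NI.
- apply: (@collapse_word [::] [:: true; false]) => // x y Px Py.
  rewrite [RHS]ev_sandwich !H // !evE !mul1g !mulg1.
  by have := H x y Px Py; rewrite !evE !mulg1 => ->.
- by apply: (@collapse_end_y (false :: s)).
have stretch x y : P x -> P y -> x * y * x = x * y ^+ n.+1 * x.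
  move=> Px Py; have PX : P (y ^+ n.+1) by rewrite expgS; apply: PMl.
  rewrite -!ev_xyx !H //; exact: (proj1 (ev_long_blocks s Px Py)).
have Pre t : s = false :: t -> collapse.
  move=> E; apply: (@collapse_pre_sq false) => x y Px Py.
  by exists (ev x y (rcons t false)); rewrite -ev_xyx H // E rcons_cons !ev_cons mulgA.
have Post t : s = rcons t false -> collapse.
  move=> E; apply: (@collapse_post_sq false) => x y Px Py.
  exists (ev x y (false :: t)).
  by rewrite -ev_xyx H // E -!cats1 -catA -cat_cons ev_cat !evE mulg1.
have [[|c] [t [Es []]]] := run true s.
- move=> E; apply: (@collapse_pre_sq false) => x y Px Py.
  by exists 1; rewrite -ev_xyx H // Es E !evE !mulg1.
- by move=> [t' E]; apply: (Pre t'); rewrite Es E.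
- by move=> E; case/eqP: (nek c); rewrite Es E cats0.
case=> t' Et; have [d [u [Eu []]]] := run false t'.
  move=> E; apply: (Post (nseq c.+1 true ++ nseq d false)).
  by rewrite Es Et Eu E cats0 rcons_cat -cats1 -(nseqD d 1 false) addn1.
case=> u' E; have [f [v [Ev Hv]]] := run true u'.
have Ew : false :: rcons s false = false :: nseq c.+1 true ++ nseq d.+1 false
    ++ nseq f.+1 true ++ rcons v false.
  by rewrite Es Et Eu E Ev !(rcons_cat, rcons_cons).
have block p k q : false :: rcons s false = p ++ [:: false] ++ nseq k.+1 true
    ++ [:: false] ++ q -> exists k', k = k'.+1.
  case: k => [|k] E1; last by exists k.
  by case/negP: NI; rewrite E1; apply/infixP; exists p, q.
have [c' Ec] : exists k, c = k.+1.
  by apply: (block [::] c (nseq d false ++ nseq f.+1 true ++ rcons v false)); rewrite Ew.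
have [f' Ef] : exists k, f = k.+1.
  have [q Eq] : exists q, rcons v false = false :: q.
    by case: Hv => [->|[v' ->]]; eexists; rewrite ?rcons_cons.
  apply: (block (false :: nseq c.+1 true ++ nseq d false) f q).
  by rewrite Ew Eq -[d.+1]addn1 (nseqD d) /= -!catA.
apply: (@collapse_long_blocks d) => // x y Px Py.
exists (x * y ^+ c'), (y ^+ f' * ev x y (rcons v false)).
rewrite -ev_xyx H // Ew Ec Ef -[c'.+2]addn2 -[f'.+2]add2n (nseqD c') (nseqD 2 f').
by rewrite !evE !mulgA.
Qed.

End Core.

(* Words on the generators are lists of booleans, [false] standing for [x] and [true] for
   [y], as in the presentations; the empty word is a name for the zero. *)
Definition wd (w : seq bool) : free0 bool := if w is a :: s then Some (a, s) else None.

Lemma wd_cat u v : u != [::] -> v != [::] -> wd (u ++ v) = wd u * wd v.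
Proof. by case: u v => [|a u] [|b v]. Qed.

(** * Words modulo a presentation *)

Section WordCongruence.
Variable R : seq (free0 bool * free0 bool).

Definition weq u v := congruence R (wd u) (wd v).

Lemma weq_refl u : weq u u. Proof. exact: cong_refl. Qed.

Lemma weq_sym u v : weq u v -> weq v u. Proof. exact: cong_sym. Qed.

Lemma weq_trans v u w : weq u v -> weq v w -> weq u w. Proof. exact: cong_trans. Qed.

(** The nonemptiness conditions are essential: an empty u or v names the zero, which a context
    absorbs, whereas concatenation with the empty list would keep the context. *)
Lemma weq_ctx p q u v : weq u v -> u != [::] -> v != [::] ->
  weq (p ++ u ++ q) (p ++ v ++ q).
Proof.
move=> E u0 v0.
have E1 : weq (u ++ q) (v ++ q).
  have [->|q0] := eqVneq q [::]; first by rewrite !cats0.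
  by rewrite /weq !wd_cat //; apply: cong_mul => //; exact: cong_refl.
have [->//|p0] := eqVneq p [::].
have [uq vq] : u ++ q != [::] /\ v ++ q != [::] by case: (u) (v) u0 v0 => [|??] [].
by rewrite /weq (wd_cat p0 uq) (wd_cat p0 vq); apply: cong_mul => //; exact: cong_refl.
Qed.

Lemma wz_ctx p q u : weq u [::] -> u != [::] -> weq (p ++ u ++ q) [::].
Proof.
move=> E u0.
have E1 : weq (u ++ q) [::].
  have [->|q0] := eqVneq q [::]; first by rewrite cats0.
  rewrite /weq wd_cat //; apply: cong_trans (cong_mul E (cong_refl _ _)) _.
  exact: cong_refl.
have [->//|p0] := eqVneq p [::].
have uq : u ++ q != [::] by case: (u) u0.
rewrite /weq wd_cat //; apply: cong_trans (cong_mul (cong_refl _ _) E1) _.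
by case: (p) => [|a l]; exact: cong_refl.
Qed.

Lemma not_cyclically_regular :
  (forall s, weq ([:: true; false] ++ s ++ [:: false; true]) [::]) ->
  ~ weq [:: false; true; false] [::] -> ~ cyclically_regular (presented R).
Proof.
move=> Z NZ H; apply: NZ.
pose pi u : presented R := (\pi_(presented R) u)%qT.
have piM u v : pi (u * v) = pi u * pi v by exact: presented_mul_pi.
have [|s] := H (pi (wd [:: false; true; false])).
  exists (pi (wd [:: false])); right; exists (pi (wd [:: true])).
  by rewrite -!piM.
elim/quotW: s => s; rewrite -/(pi s) -!piM => /presentedP E.
apply: cong_trans E _; case: s => [[a s]|]; last exact: cong_refl.
have := wz_ctx [:: false] [:: false] (Z (a :: s)).
rewrite -catA => /(_ isT); apply: cong_trans; rewrite /= -catA; exact: cong_refl.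
Qed.

(* A right action of the generators on [nat], undefined on words equal to zero. *)
Variable step : bool -> nat -> option nat.

Definition act (u : free0 bool) (q : nat) : option nat :=
  if u is Some (a, s) then foldl (fun r b => obind (step b) r) (step a q) s else None.

Lemma actM u v q : act (u * v) q = obind (act v) (act u q).
Proof.
case: u v => [[a s]|] [[b t]|] //=; last by case: foldl.
rewrite foldl_cat /=; case: (foldl _ (step a q) s) => //=.
by elim: t => //= c t <-.
Qed.

Lemma act_congruence u v :
  (forall r, r \in R -> act r.1 =1 act r.2) -> congruence R u v -> act u =1 act v.
Proof.
move=> H; elim=> {u v} [u v /H //|//|u v _ E q|u v w _ E _ F q|u u' v v' _ E _ F q].
- by rewrite E.
- by rewrite E F.
- by rewrite !actM E; case: (act u' q) => //= r; rewrite F.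
Qed.

Lemma act_nonzero w q :
  (forall r, r \in R -> act r.1 =1 act r.2) -> act (wd w) q -> ~ weq w [::].
Proof. by move=> H A /(act_congruence H)/(_ q) E; rewrite E in A. Qed.

End WordCongruence.

Definition rel_of (l : seq (seq bool * seq bool)) := [seq (wd p.1, wd p.2) | p <- l].

Lemma weq_rel l u v : (u, v) \in l -> weq (rel_of l) u v.
Proof. by move=> uv; apply/cong_rel/mapP; exists (u, v). Qed.

Local Notation x := false (only parsing).
Local Notation y := true (only parsing).

Definition relA := rel_of [:: ([:: x], [:: x; x]); ([:: y; y], [::]); ([:: x; y], [:: y; x])].
Definition relB := rel_of [:: ([:: x; x], [::]); ([:: y; y], [::]); ([:: x; y; x], [:: y; x; y])].
Definition relCl := rel_of [:: ([:: x; x], [:: x; x; x]); ([:: x; y], [:: y]);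
  ([:: y; x; x], [::]); ([:: y; y], [::])].
Definition relCr := rel_of [:: ([:: x; x], [:: x; x; x]); ([:: y; x], [:: y]);
  ([:: x; x; y], [::]); ([:: y; y], [::])].
Definition relD := rel_of [:: ([:: x; x], [::]); ([:: y], [:: y; y]); ([:: y; x; y], [::])].
Definition relK n := rel_of ([:: ([:: x; x], [::]); (nseq 2 y, nseq (n + 2) y);
    ([:: y; x; y], [::]); ([:: x; y; x], x :: nseq (n + 1) y ++ [:: x])]
  ++ [seq (x :: nseq q y ++ [:: x], [::]) | q <- iota 2 n.-1]).

Lemma spow_gen (b : bool) k : (gen0 b : free0 bool) ^^ k.+1 = wd (nseq k.+1 b).
Proof.
elim: k => // k IH; have -> : (gen0 b : free0 bool) ^^ k.+2 = gen0 b * gen0 b ^^ k.+1 by [].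
by rewrite IH.
Qed.

Lemma semigroupKE n : semigroupK n = presented (relK n).
Proof.
congr presented; rewrite /relK /rel_of map_cat; congr (_ ++ _).
  by rewrite /= addn2 addn1 !spow_gen.
rewrite -map_comp; apply/eq_in_map => q; rewrite mem_iota => /andP[q2 _].
by case: q q2 => // q _; rewrite spow_gen.
Qed.

(** * The listed semigroups are not cyclically regular *)

Ltac check_action :=
  let r := fresh in move=> r; rewrite !inE; repeat case/orP; move/eqP=> -> /=;
  (do 7 try case=> //).

(** The hypotheses concern yxyx and yxyy rather than yxy so as to cover B, where yxy is nonzero. *)
Lemma yx_xy_zero R : weq R [:: x; x] [::] -> weq R [:: y; x; y; x] [::] ->
  weq R [:: y; x; y; y] [::] ->
  forall s, weq R ([:: y; x] ++ s ++ [:: x; y]) [::].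
Proof.
move=> xx yxyx yxyy [|[] s]; first exact: (wz_ctx [:: y] [:: y] xx isT).
  case: s => [|[] s]; first exact: (wz_ctx [::] [:: y] yxyx isT).
    exact: (wz_ctx [::] (s ++ [:: x; y]) yxyy isT).
  exact: (wz_ctx [::] (s ++ [:: x; y]) yxyx isT).
exact: (wz_ctx [:: y] (s ++ [:: x; y]) xx isT).
Qed.

Lemma two_y_zero_right R : weq R [:: y; y] [::] -> weq R [:: x; y] [:: y] ->
  forall s, weq R ([:: y] ++ s ++ [:: y]) [::].
Proof.
move=> yy xy; elim/last_ind => [//|s [] IH]; rewrite cat_rcons.
  exact: (wz_ctx ([:: y] ++ s) [::] yy isT).
apply: weq_trans IH; exact: (weq_ctx ([:: y] ++ s) [::] xy isT isT).
Qed.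

Lemma two_y_zero_left R : weq R [:: y; y] [::] ->
  weq R [:: y; x] [:: y] \/ weq R [:: y; x] [:: x; y] ->
  forall s, weq R ([:: y] ++ s ++ [:: y]) [::].
Proof.
move=> yy yx; elim => [//|[] s IH]; first exact: (wz_ctx [::] (s ++ [:: y]) yy isT).
case: yx => yx; apply: weq_trans (weq_ctx [::] (s ++ [:: y]) yx isT isT) _ => //.
by have := wz_ctx [:: x] [::] IH isT; rewrite cats0.
Qed.

Lemma A_yy s : weq relA ([:: y] ++ s ++ [:: y]) [::].
Proof. by apply: two_y_zero_left; [|right; apply: weq_sym]; apply: weq_rel. Qed.

Lemma Cl_yy s : weq relCl ([:: y] ++ s ++ [:: y]) [::].
Proof. by apply: two_y_zero_right; apply: weq_rel. Qed.

Lemma Cr_yy s : weq relCr ([:: y] ++ s ++ [:: y]) [::].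
Proof. by apply: two_y_zero_left; [|left]; apply: weq_rel. Qed.

Lemma B_alt : weq relB [:: y; x; y; x] [::].
Proof.
have xx : weq relB [:: x; x] [::] by exact: weq_rel.
have yxy : weq relB [:: y; x; y] [:: x; y; x] by apply: weq_sym; exact: weq_rel.
apply: (weq_trans (weq_ctx [::] [:: x] yxy isT isT)).
exact: (wz_ctx [:: x; y] [::] xx isT).
Qed.

Lemma A_not_cyclically_regular : ~ cyclically_regular semigroupA.
Proof.
apply: (@not_cyclically_regular relA) => [s|].
  by have := A_yy (x :: s ++ [:: x]); rewrite /= -catA.
(* The state counts the letters y read so far; x acts as the identity. *)
apply: (@act_nonzero _
  (fun b q => if b then if q is 0 then Some 1 else None else Some q)%N _ 0) => //.
check_action.
Qed.

Lemma B_not_cyclically_regular : ~ cyclically_regular semigroupB.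
Proof.
apply: (@not_cyclically_regular relB) => [s|].
  apply: yx_xy_zero; [exact: weq_rel|exact: B_alt|].
  have yy : weq relB [:: y; y] [::] by exact: weq_rel.
  exact: (wz_ctx [:: y; x] [::] yy isT).
(* states: 0 = 1, 1 = x, 2 = y, 3 = xy, 4 = yx, 5 = xyx *)
apply: (@act_nonzero _ (fun b q =>
  match q, b with
  | 0, false => Some 1 | 0, true => Some 2 | 1, true => Some 3 | 2, false => Some 4
  | 3, false => Some 5 | 4, true => Some 5 | _, _ => None
  end)%N _ 0) => //.
check_action.
Qed.

Lemma Cl_not_cyclically_regular : ~ cyclically_regular semigroupC_lambda.
Proof.
apply: (@not_cyclically_regular relCl) => [s|].
  by have := Cl_yy (x :: s ++ [:: x]); rewrite /= -catA.
(* States: 0 for any power of x, 1 = y = xy, 2 = yx. *)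
apply: (@act_nonzero _ (fun b q =>
  match q, b with
  | 0, false => Some 0 | 0, true => Some 1 | 1, false => Some 2 | _, _ => None
  end)%N _ 0) => //.
check_action.
Qed.

Lemma Cr_not_cyclically_regular : ~ cyclically_regular semigroupC_rho.
Proof.
apply: (@not_cyclically_regular relCr) => [s|].
  by have := Cr_yy (x :: s ++ [:: x]); rewrite /= -catA.
(* states: 0 = 1, 1 = x, 2 = x^2, 3 = y = xy *)
apply: (@act_nonzero _ (fun b q =>
  match q, b with
  | 0, false => Some 1 | 0, true => Some 3 | 1, false => Some 2 | 1, true => Some 3
  | 2, false => Some 2 | 3, false => Some 3 | _, _ => None
  end)%N _ 0) => //.
check_action.
Qed.

Lemma D_not_cyclically_regular : ~ cyclically_regular semigroupD.
Proof.
have yxy : weq relD [:: y; x; y] [::] by exact: weq_rel.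
apply: (@not_cyclically_regular relD) => [s|].
  apply: yx_xy_zero; first exact: weq_rel.
    exact: (wz_ctx [::] [:: x] yxy isT).
  exact: (wz_ctx [::] [:: y] yxy isT).
(* states: 0 = 1, 1 = x, 2 = xy, 3 = xyx *)
apply: (@act_nonzero _ (fun b q =>
  match q, b with
  | 0, false => Some 1 | 1, true => Some 2 | 2, true => Some 2 | 2, false => Some 3
  | _, _ => None
  end)%N _ 0) => //.
check_action.
Qed.

(* states: 0 = 1, 1 = x, 2 = xyx, k + 3 = x y^j for any j = k modulo n *)
Definition stepK n b q : option nat :=
  (match q, b with
  | 0, false => Some 1 | 1, true => Some (3 + 1 %% n)
  | k.+3, true => Some (3 + k.+1 %% n)
  | k.+3, false => if k == 1 %% n then Some 2 else None
  | _, _ => None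
  end)%N.

Lemma act_ycycle n m k :
  foldl (fun r b => obind (stepK n b) r) (Some k.+3) (nseq m.+1 y)
  = Some ((k + m.+1) %% n).+3.
Proof.
elim: m k => [|m IH] k; first by rewrite addn1.
by have := IH (k.+1 %% n); rewrite modnDml addSnnS.
Qed.

Lemma act_xy n m :
  foldl (fun r b => obind (stepK n b) r) (Some 1%N) (nseq m.+1 y) = Some (m.+1 %% n).+3.
Proof.
case: m => // m.
by have := act_ycycle n m (1 %% n); rewrite modnDml add1n.
Qed.

Lemma K_not_cyclically_regular n : 0 < n -> ~ cyclically_regular (semigroupK n).
Proof.
move=> n0; rewrite semigroupKE.
have rel u v : (u, v) \in [:: ([:: x; x], [::]); (nseq 2 y, nseq (n + 2) y);
    ([:: y; x; y], [::]); ([:: x; y; x], x :: nseq (n + 1) y ++ [:: x])] ->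
    weq (relK n) u v.
  by move=> uv; apply: weq_rel; rewrite mem_cat uv.
have yxy : weq (relK n) [:: y; x; y] [::] by apply: rel; rewrite !inE eqxx !orbT.
apply: not_cyclically_regular => [s|].
  apply: yx_xy_zero; first by apply: rel; rewrite inE eqxx.
    exact: (wz_ctx [::] [:: x] yxy isT).
  exact: (wz_ctx [::] [:: y] yxy isT).
apply: (@act_nonzero _ (stepK n) _ 0) => //; last by rewrite /= eqxx.
have ky q k : 0 < k -> act (stepK n) (wd (nseq k y)) q
    = if q is k'.+3 then Some ((k' + k) %% n).+3
      else if q is 1%N then Some (k %% n).+3 else None.
  case: k => // k _; case: q => [|[|[|q]]].
  - by elim: k.
  - exact: act_xy.
  - by elim: k.
  - exact: act_ycycle.
have kx q k : 0 < k -> act (stepK n) (wd (x :: nseq k y ++ [:: x])) q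
    = if (q == 0) && (k %% n == 1 %% n) then Some 2%N else None.
  case: k => // k _; rewrite [LHS]foldl_cat.
  have N m : foldl (fun r b => obind (stepK n b) r) None (nseq m y) = None by elim: m.
  have Z m : foldl (fun r b => obind (stepK n b) r) (Some 2%N) (nseq m.+1 y) = None.
    exact: N.
  case: q => [|[|[|q]]]; rewrite [stepK n x _]/= ?act_xy ?N ?Z //.
  by case: ifP => _; rewrite ?N ?Z.
move=> _ /mapP[[u v] uv ->]; rewrite [X in act _ X]/= [X in _ =1 act _ X]/=.
move: uv; rewrite mem_cat => /orP[|/mapP[k + [-> ->]]]; last first.
  rewrite mem_iota => k2 q; rewrite kx; last lia.
  rewrite ifF //; apply/negP => /andP[_]; have n2 : 1 < n by lia.
  rewrite (modn_small n2); have [->|kn] := eqVneq k n; first by rewrite modnn.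
  by rewrite modn_small; lia.
rewrite !inE; case/or4P => /eqP[-> ->] q.
- by case: q => [|[|[|q]]] //=; case: ifP.
- rewrite (ky q 2) // (ky q (n + 2)%N) ?addn2 //.
  by case: q => [|[|[|q]]] //=; rewrite -[n.+2]add2n ?addnA modnDr.
- by case: q => [|[|[|q]]] //=; case: ifP.
- rewrite -[X in wd X]/(x :: nseq 1 y ++ [:: x]) !kx // ?addn1 //.
  by rewrite -[n.+1]add1n modnDr.
Qed.

(** * Excluding A *)

Definition normA (w : seq bool) : seq bool :=
  if count id w == 0 then [:: x] else
  if count id w == 1%N then (if x \in w then [:: x; y] else [:: y]) else [::].

Lemma weq_normA w : w != [::] -> weq relA w (normA w).
Proof.
have xx : weq relA [:: x] [:: x; x] by exact: weq_rel.
have xy : weq relA [:: x; y] [:: y; x] by exact: weq_rel.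
have yy : weq relA [:: y; y] [::] by exact: weq_rel.
elim: w => // b [|c s] IH _; first by case: b; exact: weq_refl.
have := IH isT; rewrite /normA (_ : count id (b :: _) = b + count id (c :: s))%N //.
have mem0 : count id (c :: s) = 0 -> x \in c :: s by case: c {IH}.
set k := count _ _ in mem0 *; set m := x \in c :: s in mem0 *.
have -> : (x \in b :: c :: s) = ~~ b || m by rewrite inE; case: b.
have left u v : weq relA (c :: s) u -> u != [::] -> weq relA (b :: u) v ->
    weq relA (b :: c :: s) v.
  by move=> E u0; have := weq_ctx [:: b] [::] E isT u0; rewrite !cats0; exact: weq_trans.
case: k mem0 => [|[|k]] mem0 E; rewrite ?addn0 ?addn1 ?addnS ?[_ == _]/=.
- apply: left E _ _ => //; case: (b) => /=; rewrite ?mem0 //; exact: weq_sym.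
- case: (m) E => E; apply: left E _ _ => //; case: (b) => /=.
  + exact: (A_yy [:: x]).
  + exact: (weq_ctx [::] [:: y] (weq_sym xx)).
  + exact: yy.
  + exact: weq_refl.
- by have := wz_ctx [:: b] [::] E isT; rewrite cats0; case: (b).
Qed.

Lemma ev_idem (M : monoidType) (e a : M) w : e * e = e -> e * a = a -> a * e = a ->
  w != [::] -> ev e a w = if count id w == 0 then e else a ^+ count id w.
Proof.
move=> ee ea ae; elim: w => // b [|c s] IH _; first by case: b; rewrite !evE mulg1.
rewrite ev_cons IH // (_ : count id (b :: _) = b + count id (c :: s))%N //.
by case: b; case: (count id (c :: s)) => [|k] //=; rewrite -?expgS // expgS mulgA ea.
Qed.

(** With b = eae, the substitution (e, b) turns a word into a power of b, or e, determined by its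
    number of y, and (b, b) turns it into b raised to its length. Words distinct in A differ in the
    number of y truncated at 2, or both have a single y and exactly one of them contains x. In
    either case one of the two substitutions gives b = b^k with k > 1. *)
Lemma local_regular_of_A (M : monoidType) (P : M -> Prop) n u v :
  (forall a b, P a -> P (a * b)) -> (forall a b, P b -> P (a * b)) -> 0 < n ->
  (forall z, P z -> z ^+ 2 = z ^+ (n + 2)) ->
  u != [::] -> v != [::] -> ~ weq relA u v -> holds P u v ->
  forall e a, P e -> e * e = e -> P a -> e * a * e = (e * a * e) ^+ n.+1.
Proof.
move=> PMl PMr n0 sq; wlog uv : u v / count id u <= count id v.
  move=> H u0 v0 E I; case/orP: (leq_total (count id u) (count id v)) => C.
    exact: H C u0 v0 E I.
  by apply: (H v u C v0 u0) => [/weq_sym//|z t Pz Pt]; rewrite I.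
move=> u0 v0 E I e a Pe ee Pa; set b := e * a * e.
have Pb : P b by exact: PMl _ _ (PMl _ _ Pe).
have [eb be] : e * b = b /\ b * e = b by rewrite /b -!mulgA ee !mulgA ee.
have reg r : b = b ^+ r.+2 -> b = b ^+ n.+1 by exact: (power_regular n0 sq Pb).
have nuv : normA u <> normA v.
  move=> N; apply: E; apply: weq_trans (weq_normA u0) _; rewrite N.
  exact/weq_sym/weq_normA.
have := I e b Pe Pb; rewrite !ev_idem //.
have := I b b Pb Pb; rewrite !ev_diag.
have size_count w : size w = (count id w + (x \in w) * count negb w)%N.
  rewrite -(count_predC id w) -has_pred1 has_count; congr addn.
  rewrite (eq_count (_ : pred1 false =1 negb)); last by case.
  by case: (count negb w) => //= k; rewrite mul1n.
rewrite !size_count; move: uv nuv; rewrite /normA -!has_pred1 !has_count.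
have -> : count_mem false = count negb by apply/funext => w; apply: eq_count; case.
case: (count id u) (count id v) => [|[|cu]] [|[|cv]] //=; try by move=> _; case.
- by move=> _ _ _; rewrite expg1 => F; apply: (reg 0); rewrite expg2 -{2}F eb.
- by move=> _ _ _ F; apply: (reg cv.+1); rewrite expgS -F be.
- case: (count negb u) (count negb v) => [|k] [|l] //= _.
  + by move=> _ + _; rewrite mul1n => /reg.
  + by move=> _ /esym + _; rewrite mul1n => /reg.
- by move=> _ _ _ /reg.
Qed.

(** * Excluding B *)

Definition nonzeroB : seq (seq bool) :=
  [:: [:: x]; [:: y]; [:: x; y]; [:: y; x]; [:: x; y; x]; [:: y; x; y]].

Lemma weqB_zero w : w != [::] -> w \notin nonzeroB -> weq relB w [::].
Proof.
have xx : weq relB [:: x; x] [::] by exact: weq_rel.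
have yy : weq relB [:: y; y] [::] by exact: weq_rel.
have xyx : weq relB [:: x; y; x] [:: y; x; y] by exact: weq_rel.
have xyxy : weq relB [:: x; y; x; y] [::].
  by apply: (weq_trans (weq_ctx [:: x] [::] (weq_sym xyx) isT isT)); apply: (wz_ctx [::] [:: y; x] xx).
elim: w => // b w IH _ bw; case: (eqVneq w [::]) bw => [->|w0] bw; first by case: b bw.
have [wL|/(IH w0) E] := boolP (w \in nonzeroB); last first.
  by have := wz_ctx [:: b] [::] E w0; rewrite cats0.
move: wL bw {IH w0}; rewrite !inE; do ?[case/orP]; move/eqP => ->; case: b => //= _.
- exact: (wz_ctx [::] [:: y] xx).
- exact: (wz_ctx [::] [:: x] yy).
- exact: B_alt.
- exact: (wz_ctx [::] [:: y; x] xx).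
- exact: (wz_ctx [::] [:: x; y] yy).
Qed.

Section Theory.
Variable E : seq bool -> seq bool -> Prop.
Hypothesis E_sym : forall u v, E u v -> E v u.
Hypothesis E_ctx : forall p q u v, E u v -> E (p ++ u ++ q) (p ++ v ++ q).

(** Every nonzero element of B has a right multiple, possibly itself, equal to xyx = yxy.
    Multiplying the identity accordingly makes one side xyx or yxy; cancellation of words keeps the
    other side different from both. Exchanging the letters reduces yxy to xyx. *)
Lemma B_identity u v : (forall u v, E u v -> E (map negb u) (map negb v)) ->
  u != [::] -> v != [::] -> ~ weq relB u v -> E u v ->
  exists w, [/\ w != [:: x; y; x], w != [:: y; x; y] & E [:: x; y; x] w].
Proof.
move=> E_swap; wlog uL : u v / u \in nonzeroB => [H u0 v0 ne Euv|u0 v0 ne Euv].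
  have [uL|/(weqB_zero u0) uz] := boolP (u \in nonzeroB); first exact: H uL u0 v0 ne Euv.
  have [vL|/(weqB_zero v0) vz] := boolP (v \in nonzeroB).
    by apply: (H v u vL v0 u0) (E_sym Euv) => /weq_sym.
  by case: ne; exact: weq_trans uz (weq_sym vz).
have swapped w : w != [:: x; y; x] -> w != [:: y; x; y] -> E [:: y; x; y] w ->
    exists w, [/\ w != [:: x; y; x], w != [:: y; x; y] & E [:: x; y; x] w].
  move=> w1 w2 /E_swap Ew; exists (map negb w); split=> //.
    by apply: contra w2; case: w {w1 Ew} => [|[] [|[] [|[] [|? ?]]]].
  by apply: contra w1; case: w {w2 Ew} => [|[] [|[] [|[] [|? ?]]]].
have vu : v != u by apply/eqP => vu; apply: ne; rewrite vu; exact: weq_refl.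
have xyxE : weq relB [:: x; y; x] [:: y; x; y] by exact: weq_rel.
move: uL vu ne Euv; rewrite !inE; do ?[case/orP]; move/eqP => -> ne nw Euv.
- exists (v ++ [:: y; x]); split; last exact: (E_ctx [::] [:: y; x] Euv).
    by apply: contra ne; case: v {v0 Euv nw} => [|[] [|[] [|[] [|? ?]]]].
  by case: v {v0 Euv ne nw} => [|[] [|[] [|[] [|? ?]]]].
- apply: (swapped (v ++ [:: x; y])); last exact: (E_ctx [::] [:: x; y] Euv).
    by case: v {v0 Euv ne nw} => [|[] [|[] [|[] [|? ?]]]].
  by apply: contra ne; case: v {v0 Euv nw} => [|[] [|[] [|[] [|? ?]]]].
- exists (v ++ [:: x]); split; last exact: (E_ctx [::] [:: x] Euv).
    by apply: contra ne; case: v {v0 Euv nw} => [|[] [|[] [|[] [|? ?]]]].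
  by case: v {v0 Euv ne nw} => [|[] [|[] [|[] [|? ?]]]].
- apply: (swapped (v ++ [:: y])); last exact: (E_ctx [::] [:: y] Euv).
    by case: v {v0 Euv ne nw} => [|[] [|[] [|[] [|? ?]]]].
  by apply: contra ne; case: v {v0 Euv nw} => [|[] [|[] [|[] [|? ?]]]].
- exists v; split=> //; apply/eqP => vE; case: nw; rewrite vE; exact: xyxE.
- by apply: (swapped v) => //; apply/eqP => vE; case: nw; rewrite vE; exact: weq_sym.
Qed.

(** * Excluding C_lambda *)

Definition shortened z := (exists a t, z = nseq a x ++ [:: y; x; x] ++ t) \/
  (exists a b t, z = nseq a x ++ y :: nseq b x ++ y :: t).

Lemma shortened_cat z t : shortened z -> shortened (z ++ t).
Proof.
by case=> [[a [r ->]]|[a [b [r ->]]]]; [left; exists a, (r ++ t)|right; exists a, b, (r ++ t)];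
  rewrite -!catA //= -catA.
Qed.

Lemma shortened_zero z : shortened z -> weq relCl z [::].
Proof.
case=> [[a [t ->]]|[a [b [t ->]]]].
  have yxx : weq relCl [:: y; x; x] [::] by exact: weq_rel.
  exact: (wz_ctx _ _ yxx).
by have := wz_ctx (nseq a x) t (Cl_yy (nseq b x)) isT; rewrite -!catA.
Qed.

(** The first three shapes represent the nonzero elements x, x^2, y and yx of C_lambda, so
    [shortened] describes exactly the nonempty words equal to zero. *)
Lemma Cl_spec w : w != [::] ->
  [\/ exists a, w = nseq a.+1 x, exists a, w = nseq a x ++ [:: y],
      exists a, w = nseq a x ++ [:: y; x] | shortened w].
Proof.
have [a [t [-> [->|[t' ->]]]]] := run false w.
  by case: a => // a _; apply: Or41; exists a; rewrite cats0.
move=> _; have [[|[|b]] [r [-> [->|[r' ->]]]]] := run false t'.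
- by apply: Or42; exists a.
- by apply: Or44; right; exists a, 0, r'.
- by apply: Or43; exists a.
- by apply: Or44; right; exists a, 1%N, r'.
- by apply: Or44; left; exists a, (nseq b x ++ [::]).
- by apply: Or44; left; exists a, (nseq b x ++ ~~ false :: r').
Qed.

(** Multiplication by x or yx on the right, or by y on the left, brings one side to the form x^N yx
    and makes the other zero in C_lambda. Two powers of x can only be distinct there if one of them
    is x itself. *)
Lemma Cl_identity u v : u != [::] -> v != [::] -> ~ weq relCl u v -> E u v ->
  exists N z, shortened z /\ E (nseq N x ++ [:: y; x]) z.
Proof.
pose goal := exists N z, shortened z /\ E (nseq N x ++ [:: y; x]) z.
rewrite -/goal.
have xx : weq relCl [:: x; x] [:: x; x; x] by exact: weq_rel.
have xy : weq relCl [:: x; y] [:: y] by exact: weq_rel.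
have pow a : weq relCl (nseq a.+2 x) [:: x; x].
  elim: a => [|a IH]; first exact: weq_refl.
  by apply: weq_trans (weq_ctx [::] (nseq a x) (weq_sym xx) isT isT) _.
have del a t : weq relCl (nseq a x ++ y :: t) (y :: t).
  elim: a => [|a IH]; first exact: weq_refl.
  have := weq_ctx [:: x] [::] IH; rewrite !cats0 => H.
  apply: weq_trans (H _ isT) (weq_ctx [::] t xy isT isT).
  by case: (a).
have goal_yx a w : shortened w -> E (nseq a x ++ [:: y; x]) w ->
    goal by move=> ? ?; exists a, w.
have right t a w : E (nseq a x ++ t) w -> forall q, E (nseq a x ++ t ++ q) (w ++ q).
  by move=> F q; have := E_ctx [::] q F; rewrite -catA.
have case_y a w : shortened w -> E (nseq a x ++ [:: y]) w ->
    goal.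
  move=> sw /right/(_ [:: x]); apply: goal_yx; exact: shortened_cat.
have case_x a w : shortened w -> E (nseq a x) w ->
    goal.
  move=> sw F; have := E_ctx [::] [:: y; x] F; apply: goal_yx; exact: (shortened_cat _ sw).
have xx_case a b : a < b -> ~ weq relCl (nseq a.+1 x) (nseq b.+1 x) ->
    E (nseq a.+1 x) (nseq b.+1 x) ->
    goal.
  case: a b => [|a] [|b] // _ ne F; last first.
    by case: ne; apply: weq_trans (pow a) (weq_sym (pow b)).
  have := E_ctx [:: y] [::] F; rewrite !cats0; apply: (goal_yx 0).
  by left; exists 0, (nseq b x).
have x_y a b : E (nseq a.+1 x) (nseq b x ++ [:: y]) ->
    goal.
  move=> F; have := E_ctx [::] [:: y; x] F; apply: goal_yx.
  by right; exists b, 0, [:: x]; rewrite -catA.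
have x_yx a b : E (nseq a.+1 x) (nseq b x ++ [:: y; x]) ->
    goal.
  move=> F; have := E_ctx [::] [:: y; x] F; apply: goal_yx.
  by right; exists b, 1%N, [:: x]; rewrite -catA.
have y_yx a b : E (nseq a x ++ [:: y]) (nseq b x ++ [:: y; x]) ->
    goal.
  move=> /right/(_ [:: x]); rewrite -catA; apply: goal_yx.
  by left; exists b, [::].
move=> u0 v0 ne F; have F' := E_sym F.
case: (Cl_spec u0) ne F F' => [[a ->]|[a ->]|[a ->]|su];
  case: (Cl_spec v0) => [[b ->]|[b ->]|[b ->]|sv] ne F F'; eauto.
- have [ab|ba|ab] := ltngtP a b; first exact: xx_case ab ne F.
    by apply: xx_case ba _ F' => /weq_sym.
  by case: ne; rewrite ab; exact: weq_refl.
- by case: ne; exact: weq_trans (del a [::]) (weq_sym (del b [::])).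
- by case: ne; exact: weq_trans (del a [:: x]) (weq_sym (del b [:: x])).
- by case: ne; exact: weq_trans (shortened_zero su) (weq_sym (shortened_zero sv)).
Qed.

End Theory.

(** * Excluding C_rho, by reversal of words *)

Definition rev0 (u : free0 bool) : free0 bool :=
  if u is Some (a, s) then wd (rev (a :: s)) else None.

Lemma rev0_wd w : rev0 (wd w) = wd (rev w).
Proof. by case: w. Qed.

Lemma rev0M u v : rev0 (u * v) = rev0 v * rev0 u.
Proof.
have ne c r : rev (c :: r : seq bool) != [::] by rewrite -size_eq0 size_rev.
case: u v => [[a s]|] [[b t]|] //.
- by rewrite -[RHS](wd_cat (ne b t) (ne a s)) -rev_cat.
- by rewrite /rev0; case: (rev _).
Qed.

Lemma weq_rev l u v : weq (rel_of l) u v ->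
  weq (rel_of [seq (rev p.1, rev p.2) | p <- l]) (rev u) (rev v).
Proof.
rewrite /weq -!rev0_wd; elim=> {u v} [_ _ /mapP[p pl [-> ->]]|u|u v _|u v w _ + _|u u' v v' _ + _].
- rewrite !rev0_wd; apply: cong_rel; apply/mapP; exists (rev p.1, rev p.2) => //.
  by apply/mapP; exists p.
- exact: cong_refl.
- exact: cong_sym.
- exact: cong_trans.
- by rewrite !rev0M => ? ?; apply: cong_mul.
Qed.

(** C_rho is the dual of C_lambda, so [Cl_identity] applies to the theory of reversed identities;
    this is why that lemma is stated for an abstract relation [E]. *)
Lemma Cr_identity (E : seq bool -> seq bool -> Prop) u v :
  (forall u v, E u v -> E v u) ->
  (forall p q u v, E u v -> E (p ++ u ++ q) (p ++ v ++ q)) ->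
  u != [::] -> v != [::] -> ~ weq relCr u v -> E u v ->
  exists N z, shortened z /\ E ([:: x; y] ++ nseq N x) (rev z).
Proof.
move=> Es Ec u0 v0 ne Euv.
have [||||||N [z [sz H]]] := @Cl_identity (fun u v => E (rev u) (rev v)) _ _ (rev u) (rev v).
- by move=> ? ?; exact: Es.
- by move=> p q s t; rewrite !rev_cat -!catA; exact: Ec.
- by rewrite -size_eq0 size_rev size_eq0.
- by rewrite -size_eq0 size_rev size_eq0.
- by move/weq_rev; rewrite !revK.
- by rewrite !revK.
by exists N, z; split=> //; move: H; rewrite rev_cat rev_nseq.
Qed.

(** * The shift conditions on x^N yx and xyx^N *)

Section Shift.
Variables (M : monoidType) (P : M -> Prop).
Hypotheses (PMl : forall a b, P a -> P (a * b)) (PMr : forall a b, P b -> P (a * b)).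

(** Substituting a^2 b for y makes every y carry a square on its left. A factor yx^2 of z then
    contains a^2 b a^2, and so does y x^j y, because a^j commutes with the square that follows it.
    The same substitution raises the exponent N to N + 2 on the other side. *)
Lemma shift_left_of_Cl N z : shortened z -> holds P (nseq N x ++ [:: y; x]) z ->
  forall a b, P a -> P b -> a ^+ (N + 2) * b * a <=J a ^+ 2 * b * a ^+ 2.
Proof.
move=> sz H a b Pa Pb; have := H a (a ^+ 2 * b) Pa (PMr _ Pb).
have -> : a ^+ (N + 2) * b * a = ev a (a ^+ 2 * b) (nseq N x ++ [:: y; x]).
  by rewrite !evE mulg1 expgnDr !mulgA.
move->; case: sz => [[i [t ->]]|[i [j [t ->]]]]; rewrite !evE.
  by exists (a ^+ i), (ev a (a ^+ 2 * b) t); rewrite mulg1 !expg2 !mulgA.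
exists (a ^+ i), (a ^+ j * b * ev a (a ^+ 2 * b) t).
have c : a ^+ j * a = a * a ^+ j by rewrite -expgSr expgS.
by rewrite !mulgA; do 2!rewrite -(mulgA _ (a ^+ j) a) c !mulgA.
Qed.

Lemma shift_right_of_Cr N z : shortened z -> holds P ([:: x; y] ++ nseq N x) (rev z) ->
  forall a b, P a -> P b -> a * b * a ^+ (N + 2) <=J a ^+ 2 * b * a ^+ 2.
Proof.
move=> sz H a b Pa Pb; have := H a (b * a ^+ 2) Pa (PMl _ Pb).
have -> : a * b * a ^+ (N + 2) = ev a (b * a ^+ 2) ([:: x; y] ++ nseq N x).
  by rewrite !evE mulg1 addnC expgnDr !mulgA.
move->; case: sz => [[i [t ->]]|[i [j [t ->]]]].
  rewrite !rev_cat rev_nseq !evE.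
  by exists (ev a (b * a ^+ 2) (rev t)), (a ^+ i); rewrite mulg1 !expg2 !mulgA.
rewrite rev_cat rev_cons rev_cat rev_cons !rev_nseq -!cats1 !evE.
exists (ev a (b * a ^+ 2) (rev t) * b * a ^+ j), (a ^+ i).
have c : a ^+ j * a = a * a ^+ j by rewrite -expgSr expgS.
by rewrite !mulg1 !mulgA; do 2!rewrite -(mulgA _ (a ^+ j) a) c !mulgA.
Qed.

End Shift.

(** * Words in K_n *)

Section KWords.
Variable n : nat.
Hypothesis n_gt0 : 0 < n.

Lemma weqK_rel u v : (u, v) \in [:: ([:: x; x], [::]); (nseq 2 y, nseq (n + 2) y);
    ([:: y; x; y], [::]); ([:: x; y; x], x :: nseq (n + 1) y ++ [:: x])] ->
  weq (relK n) u v.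
Proof. by move=> uv; apply: weq_rel; rewrite mem_cat uv. Qed.

Lemma weqK_pow k l : 1 < k -> 1 < l -> k %% n = l %% n -> weq (relK n) (nseq k y) (nseq l y).
Proof.
have yy : weq (relK n) (nseq 2 y) (nseq (n + 2) y).
  by apply: weqK_rel; rewrite !inE eqxx orbT.
have step i j : weq (relK n) (nseq i.+2 y) (nseq (i.+2 + j * n) y).
  elim: j => [|j IH]; first by rewrite addn0; exact: weq_refl.
  have ne : nseq (n + 2) y != [::] by rewrite addn2.
  have := weq_ctx [::] (nseq (i + j * n) y) yy isT ne; rewrite !cat0s -!nseqD.
  rewrite (_ : 2 + (i + j * n) = i.+2 + j * n)%N; last lia.
  rewrite (_ : n + 2 + (i + j * n) = i.+2 + j.+1 * n)%N; last lia.
  exact: weq_trans IH.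
wlog kl : k l / k <= l.
  by move=> H k1 l1 E; case/orP: (leq_total k l) => kl;
    [|apply: weq_sym]; exact: H.
case: k kl => [|[|k]] // kl _ _ /eqP; rewrite eq_sym eqn_mod_dvd // => /dvdnP[j E].
by rewrite -(subnKC kl) E.
Qed.

Lemma weqK_xyx k : 0 < k -> k %% n = 1 %% n ->
  weq (relK n) [:: x; y; x] (x :: nseq k y ++ [:: x]).
Proof.
case: k => [|[|k]] // _ E; first exact: weq_refl.
apply: (weq_trans (v := x :: nseq (n + 1) y ++ [:: x])).
  by apply: weqK_rel; rewrite !inE eqxx !orbT.
have F : weq (relK n) (nseq (n + 1) y) (nseq k.+2 y).
  by apply: weqK_pow; rewrite ?E ?modnDl //; lia.
by apply: (weq_ctx [:: x] [:: x] F); rewrite -size_eq0 size_nseq; lia.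
Qed.

Lemma weqK_zero k : 0 < k -> k %% n <> 1 %% n ->
  weq (relK n) (x :: nseq k y ++ [:: x]) [::].
Proof.
(* q is the representative of the exponent modulo n between 2 and n + 1; the value n + 1 is excluded
   by [ne], so a relation xy^q x = 0 is available. *)
case: k => [|[|k]] // _ ne; set q := (k %% n).+2.
have qE : q %% n = k.+2 %% n by rewrite /q -addn2 modnDml addn2.
have qn : q <= n.
  have : k %% n < n by rewrite ltn_mod.
  rewrite leq_eqVlt => /predU1P[F|]; last by rewrite /q; lia.
  by case: ne; rewrite -qE /q -add1n F -addn1 modnDr // add1n -[n.+1]add1n modnDr.
have F : weq (relK n) (nseq k.+2 y) (nseq q y) by exact: weqK_pow.
apply: weq_trans (weq_ctx [:: x] [:: x] F isT isT) _.
apply: weq_rel; rewrite mem_cat; apply/orP; right; apply/mapP; exists q => //.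
by rewrite mem_iota /q; lia.
Qed.

Lemma K_spec w : w != [::] -> ~ weq (relK n) w [::] ->
  [\/ exists k, w = nseq k.+1 y, exists k, w = x :: nseq k y,
      exists k, w = nseq k y ++ [:: x] |
      exists k, w = x :: nseq k.+1 y ++ [:: x] /\ k.+1 %% n = 1 %% n].
Proof.
have xx : weq (relK n) [:: x; x] [::] by exact: weqK_rel.
have yxy : weq (relK n) [:: y; x; y] [::] by apply: weqK_rel; rewrite !inE eqxx !orbT.
have [k [t [-> [->|[t' ->]]]]] := run true w.
  by case: k => // k _ _; apply: Or41; exists k; rewrite cats0.
move=> _; have [l [r [-> [->|[r' ->]]]]] := run true t'; rewrite ?cats0.
  case: k l => [|k] [|l] nz.
  - by apply: Or42; exists 0.
  - by apply: Or42; exists l.+1.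
  - by apply: Or43; exists k.+1.
  case: nz; rewrite -addn1 nseqD -catA.
  exact: (wz_ctx (nseq k y) (nseq l y) yxy).
case: l => [|l] nz.
  by case: nz; exact: (wz_ctx (nseq k y) r' xx).
case: k nz => [|k] nz; last first.
  case: nz; rewrite -[k.+1]addn1 nseqD -catA.
  exact: (wz_ctx (nseq k y) (nseq l y ++ ~~ y :: r') yxy).
case: r' nz => [|[] r'] nz.
- apply: Or44; exists l; split=> //.
  by have [//|F] := pselect (l.+1 %% n = 1 %% n); case: nz; exact: weqK_zero.
- case: nz; rewrite -[l.+1]addn1 nseqD -catA.
  exact: (wz_ctx (x :: nseq l y) r' yxy).
case: nz; rewrite cat0s.
exact: (wz_ctx (x :: nseq l.+1 y) r' xx).
Qed.

End KWords.

Lemma cat_nseq_inv (b : bool) p v q c : p ++ v ++ q = nseq c b -> v = nseq (size v) b.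
Proof.
move=> E; apply/all_pred1P; have: all (pred1 b) (p ++ v ++ q).
  by rewrite E all_nseq /= eqxx orbT.
by rewrite !all_cat => /and3P[].
Qed.

Lemma cons_rcons_inj (T : eqType) (a b : T) s t : a :: rcons s b = a :: rcons t b -> s = t.
Proof. by move=> [] /eqP; rewrite eqseq_rcons eqxx andbT => /eqP. Qed.

(** * Excluding K_n when xyx = x y^(n+1) x *)

Section KCollapse.
Variables (M : monoidType) (P : M -> Prop) (n : nat).
Hypotheses (PMl : forall a b, P a -> P (a * b)) (PMr : forall a b, P b -> P (a * b)).
Hypothesis n_gt0 : 0 < n.
Hypothesis sq : forall a, P a -> a ^+ 2 = a ^+ (n + 2).
Hypothesis local_regular : forall e a, P e -> e * e = e -> P a ->
  e * a * e = (e * a * e) ^+ n.+1.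
Hypothesis shift_left : exists N, forall a b, P a -> P b ->
  a ^+ N * b * a <=J a ^+ 2 * b * a ^+ 2.
Hypothesis shift_right : exists N, forall a b, P a -> P b ->
  a * b * a ^+ N <=J a ^+ 2 * b * a ^+ 2.
Hypothesis stretch : forall a b, P a -> P b -> a * b * a = a * b ^+ n.+1 * a.

Let pre_sq := @collapse_pre_sq M P n PMl PMr n_gt0 sq local_regular shift_left shift_right.
Let post_sq := @collapse_post_sq M P n PMl PMr n_gt0 sq local_regular shift_left shift_right.

Lemma stretch_mod k a b : P a -> P b -> 0 < k -> k %% n = 1 %% n ->
  a * b * a = a * b ^+ k * a.
Proof.
move=> Pa Pb; case: k => [|[|k]] // _ E; rewrite stretch //.
by congr (_ * _ * _); apply: (expg_eqmod n_gt0 sq Pb) => //; rewrite E -[n.+1]add1n modnDr.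
Qed.

Lemma collapse_power k : (forall a, P a -> a = a ^+ k.+2) -> collapse P n.
Proof.
move=> H; apply: (pre_sq (b := false)) => a b Pa Pb.
by exists (a ^+ k * b * a); rewrite !mulgA -expgnDr -H.
Qed.

(** The word yxy is no longer exceptional: aba = bab = b a^(n+1) b = a^(n+1) b a^(n+1), which begins
    with a^2. *)
Lemma collapse_identK w : holds P [:: x; y; x] w ->
  (forall c, w != x :: rcons (nseq c.+1 y) x) -> collapse P n.
Proof.
move=> H nek; have [wE|wE] := eqVneq w [:: y; x; y]; last exact: collapse_ident H wE nek.
have I a b : P a -> P b -> a * b * a = b * a * b.
  by move=> Pa Pb; have := H a b Pa Pb; rewrite wE !evE !mulg1 !mulgA.
apply: (pre_sq (b := false)) => a b Pa Pb.
have Pz : P (a ^+ n.+1) by rewrite expgS; exact: PMl.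
exists (a ^+ n.-1 * b * a ^+ n.+1).
rewrite I // stretch // -I // !mulgA -expgnDr.
by rewrite (_ : 2 + n.-1 = n.+1)%N; last lia.
Qed.

(** A nonzero word u of K_n can be padded to x y^k x with k = 1 modulo n, whose value is that of
    xyx. Unless the collapse holds, the padded v is again of the form x y^c x, so v has the same
    shape as u. Since the lengths agree modulo n, the words can differ in K_n only if an exponent of
    y is below 2, and such an identity creates a square at an end of xyx. *)
Lemma collapse_K u v : holds P u v -> u != [::] -> v != [::] ->
  size u = size v %[mod n] -> ~ weq (relK n) u v -> collapse P n.
Proof.
wlog nz : u v / ~ weq (relK n) u [::].
  move=> W H u0 v0 s ne; have [uz|nz] := pselect (weq (relK n) u [::]); last exact: W nz H _ _ _ _.
  have [vz|nz] := pselect (weq (relK n) v [::]); first by case: ne; exact: weq_trans uz (weq_sym vz).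
  by apply: (W v u) => //; [move=> a b Pa Pb; rewrite H|move/weq_sym].
move=> H u0 v0 s ne.
have [w_|w_] := pselect (collapse P n); first by [].
have known w : holds P [:: x; y; x] w -> exists c, w = x :: rcons (nseq c.+1 y) x.
  move=> Hw; have [//|no] := pselect (exists c, w = x :: rcons (nseq c.+1 y) x).
  by case: w_; apply: (collapse_identK Hw) => c; apply/eqP => E; apply: no; exists c.
(* The two exponents of b add up to (k+1)n + 1, so the block is equivalent to a single letter while
   leaving room for a factor y^k. *)
have ev_pad a b k : P a -> P b ->
    a * b * a = a * b ^+ (k * n.-1 + 1 + n) * b ^+ k * a.
  move=> Pa Pb; rewrite -[in RHS](mulgA a) -expgnDr; apply: stretch_mod => //; first lia.
  rewrite (_ : _ + k = k.+1 * n + 1)%N ?modnMDl //.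
  by rewrite -{2 3}(prednK n_gt0); lia.
have x_pow i j : i < j -> i %% n = j %% n -> ~ weq (relK n) (x :: nseq i y) (x :: nseq j y) ->
    holds P (x :: nseq i y) (x :: nseq j y) -> collapse P n.
  case: i j => [|[|i]] [|[|j]] //= _ E F I.
  - by apply: (@collapse_power 0) => a Pa; have := I a a Pa Pa; rewrite !evE mulg1.
  - apply: (@collapse_power j.+1) => a Pa.
    by have := I a a Pa Pa; rewrite !ev_diag /= size_nseq.
  - apply: (post_sq (b := false)) => a b Pa Pb; exists (a * b * a ^+ j).
    rewrite -[RHS]mulgA -expgnDr addn2.
    have := I b a Pb Pa; rewrite -[_ :: _]/(x :: nseq 1 y) -[RHS]/(ev b a (x :: nseq j.+2 y)).
    by rewrite !evE -!mulgA => ->.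
  - case: F; have := weq_ctx [:: x] [::] (weqK_pow n_gt0 _ _ E); rewrite !cats0; exact.
have pow_x i j : i < j -> i %% n = j %% n ->
    ~ weq (relK n) (nseq i y ++ [:: x]) (nseq j y ++ [:: x]) ->
    holds P (nseq i y ++ [:: x]) (nseq j y ++ [:: x]) -> collapse P n.
  case: i j => [|[|i]] [|[|j]] //= _ E F I.
  - by apply: (@collapse_power 0) => a Pa; have := I a a Pa Pa; rewrite !evE mulg1.
  - apply: (@collapse_power j.+1) => a Pa.
    by have := I a a Pa Pa; rewrite !ev_diag /= size_cat size_nseq addn1.
  - apply: (pre_sq (b := false)) => a b Pa Pb; exists (a ^+ j * b * a).
    rewrite !mulgA -expgnDr add2n; congr (_ * _).
    have := I b a Pb Pa; rewrite -[_ :: _]/(nseq 1 y ++ [:: x]).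
    by rewrite -[RHS]/(ev b a (nseq j.+2 y ++ [:: x])) !evE !mulg1.
  - by case: F; exact: (weq_ctx [::] [:: x] (weqK_pow n_gt0 _ _ E)).
have pow i j : i < j -> i.+1 %% n = j.+1 %% n ->
    ~ weq (relK n) (nseq i.+1 y) (nseq j.+1 y) ->
    holds P (nseq i.+1 y) (nseq j.+1 y) -> collapse P n.
  case: i j => [|i] [|j] //= _ E F I; last by case: F; exact: (weqK_pow n_gt0 _ _ E).
  by apply: (@collapse_power j) => a Pa; have := I a a Pa Pa; rewrite !ev_diag /= size_nseq.
have Hs a b : P a -> P b -> ev a b v = ev a b u by move=> Pa Pb; rewrite H.
case: (K_spec n_gt0 u0 nz) => [[k uE]|[k uE]|[k uE]|[k [uE km]]].
- have [|c] := known (x :: nseq (k.+1 * n.-1 + 1 + n) y ++ v ++ [:: x]).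
    by move=> a b Pa Pb; rewrite !evE -H // uE !evE !mulg1 !mulgA; exact: ev_pad.
  rewrite catA cats1 => /cons_rcons_inj Ec.
  have vE : v = nseq (size v) y by apply: (@cat_nseq_inv _ _ v [::]); rewrite cats0; exact: Ec.
  move: s H Hs ne v0; rewrite vE uE !size_nseq; case: (size v) => // l s H Hs ne _.
  have [kl|lk|kl] := ltngtP k l; first exact: pow kl s ne H.
    by apply: pow lk (esym s) _ Hs => /weq_sym.
  by case: ne; rewrite kl; exact: weq_refl.
- have [|c] := known (v ++ nseq (k * n.-1 + 1 + n) y ++ [:: x]).
    move=> a b Pa Pb; rewrite !evE -H // uE !evE !mulg1 !mulgA.
    rewrite (ev_pad a b k) // -!(mulgA a) -!expgnDr; congr (_ * (_ ^+ _ * _)); exact: addnC.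
  case: v {v0} H Hs s ne => [|b v] H Hs s ne.
    by rewrite addn1 addSn.
  rewrite catA cats1 /= => -[bE rE]; rewrite bE in H Hs ne s *.
  have Ec : v ++ nseq (k * n.-1 + 1 + n) y = nseq c.+1 y.
    by apply: (@cons_rcons_inj _ x x); congr cons; exact: rE.
  have vE : v = nseq (size v) y by apply: (@cat_nseq_inv _ [::] v); exact: Ec.
  move: s H Hs ne; rewrite vE uE /= !size_nseq; move: (size v) => l s H Hs ne.
  have {}s : k %% n = l %% n by apply/eqP; rewrite -(eqn_modDl 1) !add1n; apply/eqP.
  have [kl|lk|kl] := ltngtP k l; first exact: x_pow kl s ne H.
    by apply: x_pow lk (esym s) _ Hs => /weq_sym.
  by case: ne; rewrite kl; exact: weq_refl.
- have [|c] := known (x :: nseq (k * n.-1 + 1 + n) y ++ v).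
    move=> a b Pa Pb; rewrite !evE -H // uE !evE !mulg1 !mulgA.
    by rewrite (ev_pad a b k) // -!mulgA.
  case/lastP: v v0 H Hs s ne => // v b _ H Hs s ne.
  rewrite -rcons_cat => /eqP; rewrite eqseq_cons eqxx eqseq_rcons /= => /andP[/eqP Ec /eqP bE].
  rewrite bE -cats1 in H Hs ne s *.
  have vE : v = nseq (size v) y by apply: (@cat_nseq_inv _ (nseq (k * n.-1 + 1 + n) y) v [::] c.+1); rewrite cats0; exact: Ec.
  move: s H Hs ne; rewrite vE uE !size_cat !size_nseq; move: (size v) => l s H Hs ne.
  have {}s : k %% n = l %% n by apply/eqP; rewrite -(eqn_modDr 1); apply/eqP.
  have [kl|lk|kl] := ltngtP k l; first exact: pow_x kl s ne H.
    by apply: pow_x lk (esym s) _ Hs => /weq_sym.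
  by case: ne; rewrite kl; exact: weq_refl.
have [|c vE] := known v.
  move=> a b Pa Pb; rewrite -H // uE !evE !mulg1.
  by rewrite mulgA (stretch_mod Pa Pb _ km) // mulgA.
have cm : c.+1 %% n = 1 %% n.
  rewrite -km; apply/eqP; rewrite eq_sym -(eqn_modDr 2); apply/eqP.
  by move: s; rewrite uE vE /= size_cat size_rcons !size_nseq /= addn1 !addn2.
case: ne; rewrite uE vE -cats1.
exact: weq_trans (weq_sym (weqK_xyx n_gt0 (ltn0Sn k) km)) (weqK_xyx n_gt0 (ltn0Sn c) cm).
Qed.

End KCollapse.

(** * Products and relatively free semigroups *)

Section Product.
Variables (I : Type) (F : I -> semigroupType).

Definition dprod : Type := forall i, F i.

HB.instance Definition _ := gen_eqMixin dprod.
HB.instance Definition _ := gen_choiceMixin dprod.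

Definition dprod_mul (a b : dprod) : dprod := fun i => a i * b i.

Lemma dprod_mulA : associative dprod_mul.
Proof. by move=> a b c; apply: functional_extensionality_dep => i; exact: mulgA. Qed.

HB.instance Definition _ := isSemigroup.Build dprod dprod_mulA.

Definition dproj i (a : dprod) : F i := a i.

Lemma dprojM i : {morph dproj i : a b / a * b}.
Proof. by []. Qed.

HB.instance Definition _ i := isMultiplicative.Build dprod (F i) (dproj i) (@dprojM i).

Lemma dprod_direct : direct_product (fun i => dproj i : {multiplicative dprod -> F i}).
Proof.
move=> a; exists a; split=> // b H; apply: functional_extensionality_dep => i.
by rewrite -(H i).
Qed.

End Product.

Section Words.
Variable X : choiceType.
Implicit Types u v : X * seq X.

Definition catw u v : X * seq X := (u.1, u.2 ++ v.1 :: v.2).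

Lemma Some_catw u v : Some (catw u v) = (Some u : free0 X) * (Some v : free0 X).
Proof. by case: u v => [a s] [b t]. Qed.

Definition evs (S : semigroupType) (g : X -> S) u : S :=
  foldl (fun s b => s * g b) (g u.1) u.2.

Lemma evs_cat (S : semigroupType) (g : X -> S) u v : evs g (catw u v) = evs g u * evs g v.
Proof.
rewrite /evs /catw foldl_cat /=; move: (foldl _ _ u.2) (g v.1) => s.
by elim: v.2 s => //= b t IH s r; rewrite -IH mulgA.
Qed.

Lemma evs_morph (S T : semigroupType) (f : {multiplicative S -> T}) (g : X -> S) u :
  f (evs g u) = evs (f \o g) u.
Proof.
by case: u => a s; elim/last_ind: s => //= s b IH; rewrite /evs !foldl_rcons gmulfM IH.
Qed.

Section Generated.
Variables (S : semigroupType) (g : X -> S).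

Definition generated : Type := {z : S | `[< exists u, z = evs g u >]}.

Definition in_generated z (zP : `[< exists u, z = evs g u >]) : generated :=
  exist (fun z : S => is_true `[< exists u, z = evs g u >]) z zP.

HB.instance Definition _ := Choice.on generated.

Lemma generated_mul_subproof (a b : generated) :
  `[< exists u, val a * val b = evs g u >].
Proof.
case: a b => [a /= /asboolP[u ->]] [b /= /asboolP[v ->]].
by apply/asboolP; exists (catw u v); rewrite evs_cat.
Qed.

Definition generated_mul (a b : generated) : generated :=
  in_generated (generated_mul_subproof a b).

Lemma generated_mulA : associative generated_mul.
Proof. by move=> a b c; apply: val_inj; exact: mulgA. Qed.

HB.instance Definition _ := isSemigroup.Build generated generated_mulA.

Definition generated_val (a : generated) : S := val a.

Lemma generated_valM : {morph generated_val : a b / a * b}.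
Proof. by []. Qed.

HB.instance Definition _ := isMultiplicative.Build generated S generated_val generated_valM.

End Generated.

(* Otherwise [presented R] would be a quotient of the relatively free semigroup of [V],
   realised inside the product of one witness for every pair of words that is not an
   identity of [V]. *)
Lemma separating_identity (V : semigroupType -> Prop)
    (R : seq (free0 X * free0 X)) (u0 : X * seq X) : variety V ->
  congruence R (Some u0) None -> ~ V (presented R) ->
  exists u v, (forall S : semigroupType, V S -> forall g : X -> S, evs g u = evs g v) /\
    ~ congruence R (Some u) (Some v).
Proof.
move=> hV zero nV; apply: contrapT => none; apply: nV.
pose fails (p : (X * seq X) * (X * seq X)) (S : semigroupType) :=
  V S /\ exists g : X -> S, evs g p.1 <> evs g p.2.
pose I := {p | exists S, fails p S}.
pose F (i : I) : semigroupType := projT1 (cid (projT2 i)).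
have FV i : V (F i) := proj1 (projT2 (cid (projT2 i))).
pose h (i : I) : X -> F i := projT1 (cid (proj2 (projT2 (cid (projT2 i))))).
have hP i : evs (h i) (projT1 i).1 <> evs (h i) (projT1 i).2 :=
  projT2 (cid (proj2 (projT2 (cid (projT2 i))))).
pose G : X -> dprod F := fun b i => h i b.
have GP u v : evs G u = evs G v -> congruence R (Some u) (Some v).
  move=> E; apply: contrapT => ne; apply: none; exists u, v; split=> // S VS g.
  apply: contrapT => neS.
  have fuv : exists S, fails (u, v) S by exists S; split=> //; exists g.
  pose i : I := exist _ (u, v) fuv; apply: (hP i).
  have := congr1 (dproj i : {multiplicative dprod F -> F i}) E; rewrite !evs_morph.
  exact.
have PV : V (dprod F) by apply: (variety_product hV) FV (@dprod_direct _ F).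
have gen0P u : `[< exists w, evs G u = evs G w >] by apply/asboolP; exists u.
pose gen u : generated G := in_generated (gen0P u).
have QV : V (generated G).
  apply: (variety_sub hV (f := @generated_val _ G)) PV _; first by exists; exact: gen u0.
  exact: val_inj.
pose word (q : generated G) := projT1 (cid (asboolW (projT2 q))).
have wordP (q : generated G) : val q = evs G (word q) := projT2 (cid (asboolW (projT2 q))).
pose phi (q : generated G) : presented R := (\pi_(presented R) (Some (word q)))%qT.
have phiM : {morph phi : a b / a * b}.
  move=> a b; rewrite /phi; apply: etrans (presented_mul_pi _ _ _).
  apply/presentedP; rewrite -Some_catw; apply: GP.
  by rewrite evs_cat -!wordP.
pose phiI := isMultiplicative.Build _ _ phi phiM.
pose phi' : {multiplicative generated G -> presented R} := HB.pack phi phiI.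
apply: (variety_image hV (f := phi')) QV _ => c.
have phi_gen u : phi (gen u) = (\pi_(presented R) (Some u))%qT.
  by apply/presentedP/GP; rewrite -wordP.
elim/quotW: c => -[u|]; first by exists (gen u); exact: phi_gen.
(* The zero of the presentation is not a word; it is reached only through the word [u0] that the
   relations send to zero. *)
by exists (gen u0); apply: etrans (phi_gen u0) _; apply/presentedP.
Qed.

End Words.

(** * Adjoining an identity *)

Section WithOne.
Variable S : semigroupType.

(** A fresh identity is adjoined even if S already has one; [nonunit] marks the elements of S, the
    only ones to be substituted for letters. *)
Definition with_one : Type := option S.

HB.instance Definition _ := Choice.on with_one.

Definition with_one_mul (a b : with_one) : with_one :=
  match a, b with
  | Some a, Some b => Some (a * b)
  | Some a, None => Some a
  | None, b => b
  end.

Lemma with_one_mulA : associative with_one_mul.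
Proof. by move=> [a|] [b|] [c|] //=; rewrite mulgA. Qed.

Lemma with_one_mul1g : left_id None with_one_mul. Proof. by case. Qed.

Lemma with_one_mulg1 : right_id None with_one_mul. Proof. by case. Qed.

HB.instance Definition _ :=
  isMonoid.Build with_one with_one_mulA with_one_mul1g with_one_mulg1.

Definition adj (a : S) : with_one := Some a.

Definition nonunit (a : with_one) : Prop := isSome a.

Lemma adjM a b : adj (a * b) = adj a * adj b. Proof. by []. Qed.

Lemma adj_inj : injective adj. Proof. by move=> a b []. Qed.

Lemma nonunit_mull a b : nonunit a -> nonunit (a * b). Proof. by case: a b => [a|] [b|]. Qed.

Lemma nonunit_mulr a b : nonunit b -> nonunit (a * b). Proof. by case: a b => [a|] [b|]. Qed.

Lemma adj_spow a k : adj (a ^^ k.+1) = adj a ^+ k.+1.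
Proof. by elim: k => // k IH; rewrite expgSS -IH. Qed.

Lemma ev_evs a b c s :
  ev (adj a) (adj b) (c :: s) = adj (evs (fun c : bool => if c then b else a) (c, s)).
Proof.
elim/last_ind: s => [|s d IH]; first by rewrite !evE mulg1; case: c.
rewrite -rcons_cons -cats1 ev_cat IH /evs foldl_rcons adjM; congr (_ * _).
by rewrite !evE mulg1; case: d.
Qed.

End WithOne.

(** * From the identities to cyclic regularity *)

Definition identities_hold n (S : semigroupType) :=
  (forall a : S, a ^^ 2 = a ^^ (n + 2)) /\
  (forall a b : S, a * b * a = (a * b) ^^ (n + 1) * a).

Lemma sq_with_one n (S : semigroupType) : (forall a : S, a ^^ 2 = a ^^ (n + 2)) ->
  forall a : with_one S, nonunit a -> a ^+ 2 = a ^+ (n + 2).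
Proof. by move=> H [a|//] _; rewrite addn2 -!adj_spow H addn2. Qed.

Lemma identities_cyclically_regular n S : 0 < n -> identities_hold n S ->
  cyclically_regular S.
Proof.
move=> n0 [sqS cyS] b [a ba].
have sq := sq_with_one sqS.
have per (c : S) k j : 1 < k -> adj c ^+ (k + j * n) = adj c ^+ k.
  by move=> k2; apply: (expg_period n0 sq).
(* The multiple 3n of the period is at least 3. Splitting off two factors thus leaves a positive
   exponent for the inner power, as required in a semigroup without identity. *)
have [m mE] : exists m, (3 * n = m.+3)%N by exists (3 * n - 3)%N; lia.
case: ba => [->|[x0 ->]].
  exists (a ^^ m.+1); apply: adj_inj; rewrite !adjM adj_spow -!expg2 -!expgnDr.
  by rewrite -{1}(per a 2 3) //; congr (_ ^+ _); lia.
exists (x0 * (a * x0) ^^ m.+1); apply: adj_inj; rewrite !adjM adj_spow adjM.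
set A := adj a; set X := adj x0; set b' := A * X * A.
have nb k : b' = (A * X) ^+ (k * n) * b'.
  elim: k => [|k IH]; first by rewrite mul0n expg0 mul1g.
  rewrite mulSn expgnDr -mulgA -IH.
  rewrite /b'; have := congr1 (@adj S) (cyS a x0).
  by rewrite addn1 !adjM adj_spow adjM -/A -/X => E; rewrite {1}E expgSr -[LHS]mulgA.
rewrite {1}(nb 3) mE (_ : m.+3 = 1 + (1 + m.+1))%N // !expgnDr !expg1 /b'.
by rewrite -!mulgA.
Qed.

Definition tt_size (u : free0 unit) := if u is Some (_, s) then minn 3 (size s).+1 else 3.

Lemma tt_size_congruence u v :
  congruence [:: (gen0 tt ^^ 3, zero0 unit)] u v -> tt_size u = tt_size v.
Proof.
have tt_sizeM r t : tt_size (r * t) = minn 3 (tt_size r + tt_size t).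
  by case: r t => [[? r]|] [[? t]|] //=; rewrite ?size_cat /=; lia.
elim=> {u v} [u v|//|//|u v w _ -> //|u u' v v' _ E _ F].
  by rewrite inE => /eqP[-> ->].
by rewrite !tt_sizeM E F.
Qed.

Lemma N3_not_cyclically_regular : ~ cyclically_regular semigroupN3.
Proof.
move=> H; pose R := [:: (gen0 tt ^^ 3, zero0 unit)].
pose pi u : presented R := (\pi_(presented R) u)%qT.
have piM u v : pi (u * v) = pi u * pi v by exact: presented_mul_pi.
have [|s] := H (pi (gen0 tt) * pi (gen0 tt)); first by exists (pi (gen0 tt)); left.
elim/quotW: s => s; rewrite -/(pi s) -!piM => /presentedP/tt_size_congruence.
by case: s => [[a s]|] //=; rewrite !size_cat /=; lia.
Qed.

(** * Combining the exclusions *)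

Section Variety.
Variables (V : semigroupType -> Prop) (hV : variety V).

Definition identity u v := forall S, V S -> holds (@nonunit S) u v.

Lemma identity_sym u v : identity u v -> identity v u.
Proof. by move=> H S VS a b Pa Pb; rewrite H. Qed.

Lemma identity_ctx p q u v : identity u v -> identity (p ++ u ++ q) (p ++ v ++ q).
Proof. by move=> H S VS a b Pa Pb; rewrite !ev_cat (H S VS a b). Qed.

Lemma identity_swap u v : identity u v -> identity (map negb u) (map negb v).
Proof. by move=> H S VS a b Pa Pb; rewrite -!ev_swap H. Qed.

Lemma failing_identity R z : weq R z [::] -> z != [::] -> ~ V (presented R) ->
  exists u v, [/\ u != [::], v != [::], identity u v & ~ weq R u v].
Proof.
case: z => // c s z0 _ nV.
have [[d u] [[e v] [I ne]]] := @separating_identity bool V R (c, s) hV z0 nV.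
exists (d :: u), (e :: v); split=> // S VS [a|//] [b|//] _ _.
by rewrite -!/(adj _) !ev_evs I.
Qed.

(** All powers of x from the third on coincide in N_3, so an identity between powers that fails
    there has a side of length at most 2. Multiplied by x if that side is x itself, it gives the
    period. *)
Lemma period_of_N3 : ~ V semigroupN3 ->
  exists n, 0 < n /\ forall S, V S -> forall a : with_one S, nonunit a -> a ^+ 2 = a ^+ (n + 2).
Proof.
pose R := [:: (gen0 tt ^^ 3, zero0 unit)] => nV.
have cube : congruence R (Some (tt, [:: tt; tt])) None by apply: cong_rel; rewrite inE.
have long s : congruence R (Some (tt, [:: tt, tt & s])) None.
  case: s => [//|[] s].
  exact: cong_trans (cong_mul cube (cong_refl R (Some (tt, s)))) (cong_refl R None).
have [[[] s] [[[] t] [I ne]]] := separating_identity hV cube nV.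
have {}I S : V S -> forall a : with_one S, nonunit a -> a ^+ (size s).+1 = a ^+ (size t).+1.
  move=> VS [a|//] _; rewrite -/(adj a).
  have E r : adj (evs (fun=> a) (tt, r)) = adj a ^+ (size r).+1.
    elim/last_ind: r => // r b IH; rewrite size_rcons expgSr -IH -adjM.
    by rewrite /evs foldl_rcons.
  by rewrite -!E I.
wlog st : s t ne I / size s <= size t.
  move=> W; case/orP: (leq_total (size s) (size t)); first exact: W.
  by apply: W => [/cong_sym//|S VS a Pa]; rewrite I.
case: s t st ne I => [|[] [|[] s]] [|[] t] //= st ne I.
- by case: ne; exact: cong_refl.
- exists (size t).+1; split=> // S VS a Pa.
  by rewrite addn2 [RHS]expgSr -(I S VS a Pa) expg1 expg2.
- case: t ne I {st} => [|[] t] ne I; first by case: ne; exact: cong_refl.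
  by exists (size t).+1; split=> // S VS a Pa; rewrite I // addn2.
- case: t ne I st => [|[] t] // ne I st.
  by case: ne; apply: cong_trans (long s) (cong_sym (long t)).
Qed.

Lemma collapse_variety : ~ V semigroupA -> ~ V semigroupB ->
  ~ V semigroupC_lambda -> ~ V semigroupC_rho -> ~ V semigroupN3 ->
  (forall n, 0 < n -> ~ V (semigroupK n)) ->
  exists n, 0 < n /\ forall S, V S -> identities_hold n S.
Proof.
move=> nA nB nCl nCr nN nK.
pose periodic n := `[< 0 < n /\ forall S, V S -> forall a : with_one S, nonunit a ->
  a ^+ 2 = a ^+ (n + 2) >].
have [|n /asboolP[n0 sq] n_min] := @ex_minnP periodic.
  by have [n H] := period_of_N3 nN; exists n; apply/asboolP.
exists n; split=> //.
suff H : forall S, V S -> collapse (@nonunit S) n.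
  move=> S VS; split=> [a|a b]; apply: adj_inj.
    by rewrite addn2 !adj_spow; have := sq S VS (adj a) isT; rewrite addn2.
  by rewrite addn1 !adjM adj_spow; exact: (H S VS (adj a) (adj b)).
(* Setting both letters to a gives a^(size u) = a^(size v). A nonzero remainder of the difference
   modulo n would be a period smaller than n. *)
have size_mod u v : identity u v -> size u = size v %[mod n].
  wlog uv : u v / size u <= size v.
    move=> W I; case/orP: (leq_total (size u) (size v)) => uv; first exact: W.
    by symmetry; apply: W uv _; exact: identity_sym.
  move=> I; apply/eqP; rewrite eq_sym eqn_mod_dvd // /dvdn -leqn0 leqNgt; apply/negP => r0.
  set d := (size v - size u)%N in r0; set r := d %% n in r0.
  suff : n <= r by rewrite leqNgt ltn_mod n0.
  apply: n_min; apply/asboolP; split=> // S VS a Pa; set m := size u in d r r0 *.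
  have per k j : 1 < k -> a ^+ (k + j * n) = a ^+ k.
    by move=> ?; apply: (expg_period n0 (sq S VS)).
  rewrite -(@expg_eqmod _ _ _ n0 (sq S VS) a (d + 2) (r + 2)) //; try lia; last by rewrite /r modnDml.
  have := I S VS a a Pa Pa; rewrite !ev_diag => E.
  rewrite -(per 2 m) // -(per (d + 2)%N m); last lia.
  have mn : m <= m * n by rewrite leq_pmulr.
  have -> : (2 + m * n = m + (2 + m * n - m))%N by lia.
  have -> : (d + 2 + m * n = size v + (2 + m * n - m))%N by rewrite /d /m in mn *; lia.
  by rewrite !expgnDr E.
have z_nA : weq relA [:: y; y] [::] by exact: weq_rel.
have [uA [vA [uA0 vA0 IA neA]]] := failing_identity z_nA isT nA.
have z_nB : weq relB [:: x; x] [::] by exact: weq_rel.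
have [uB [vB [uB0 vB0 IB neB]]] := failing_identity z_nB isT nB.
have z_nCl : weq relCl [:: y; y] [::] by exact: weq_rel.
have [ul [vl [ul0 vl0 Il nel]]] := failing_identity z_nCl isT nCl.
have z_nCr : weq relCr [:: y; y] [::] by exact: weq_rel.
have [ur [vr [ur0 vr0 Ir ner]]] := failing_identity z_nCr isT nCr.
have loc S (VS : V S) := local_regular_of_A (@nonunit_mull S) (@nonunit_mulr S) n0 (sq S VS)
  uA0 vA0 neA (IA S VS).
have [Nl [zl [sl Hl]]] := Cl_identity identity_sym identity_ctx ul0 vl0 nel Il.
have [Nr [zr [sr Hr]]] := Cr_identity identity_sym identity_ctx ur0 vr0 ner Ir.
have shl S (VS : V S) : exists N, forall a b : with_one S, nonunit a -> nonunit b ->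
    a ^+ N * b * a <=J a ^+ 2 * b * a ^+ 2.
  by exists (Nl + 2)%N; exact: shift_left_of_Cl (@nonunit_mulr S) _ _ sl (Hl S VS).
have shr S (VS : V S) : exists N, forall a b : with_one S, nonunit a -> nonunit b ->
    a * b * a ^+ N <=J a ^+ 2 * b * a ^+ 2.
  by exists (Nr + 2)%N; exact: shift_right_of_Cr (@nonunit_mull S) _ _ sr (Hr S VS).
have [w [w1 w2 Iw]] := B_identity identity_sym identity_ctx identity_swap uB0 vB0 neB IB.
have [[c wE]|no] := pselect (exists c, w = x :: rcons (nseq c.+1 y) x); last first.
  move=> S VS; apply: (collapse_ident (@nonunit_mull S) (@nonunit_mulr S) n0 (sq S VS)
    (loc S VS) (shl S VS) (shr S VS) (Iw S VS) w2) => c.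
  by apply/eqP => wE; apply: no; exists c.
have cE : c.+1 %% n = 1 %% n.
  have := size_mod _ _ Iw; rewrite wE /= size_rcons size_nseq => E.
  by apply/eqP; rewrite eq_sym -(eqn_modDr 2) !addn2; apply/eqP.
(* Since w is not xyx, the block has length at least 2, where exponents may be changed modulo n. *)
have c0 : 0 < c by case: (c) wE w1 => // ->.
have z_nK : weq (relK n) [:: x; x] [::] by exact: weqK_rel.
have nK' : ~ V (presented (relK n)) by rewrite -semigroupKE; exact: nK.
have [uK [vK [uK0 vK0 IK neK]]] := failing_identity z_nK isT nK'.
move=> S VS; apply: (collapse_K (@nonunit_mull S) (@nonunit_mulr S) n0 (sq S VS)
    (loc S VS) (shl S VS) (shr S VS) _ (IK S VS) uK0 vK0 (size_mod _ _ IK) neK).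
move=> a b Pa Pb; have := Iw S VS a b Pa Pb.
rewrite wE -cats1 !evE !mulg1 !mulgA => ->.
congr (_ * _ * _); apply: (expg_eqmod n0 (sq S VS) Pb) => //.
by rewrite cE -[n.+1]add1n modnDr.
Qed.

End Variety.

Theorem theorem1 (V : semigroupType -> Prop) (hV : variety V) :
  [<-> (* 1 *) forall S : semigroupType, V S -> cyclically_regular S;
       (* 2 *) exists n : nat, (0 < n)%N /\
         forall S : semigroupType, V S ->
           (forall x : S, x ^^ 2 = x ^^ (n + 2)) /\
           (forall x y : S, x * y * x = (x * y) ^^ (n + 1) * x);
       (* 3 *) ~ V semigroupA /\ ~ V semigroupB /\
         ~ V semigroupC_lambda /\ ~ V semigroupC_rho /\
         ~ V semigroupN3 /\ ~ V semigroupD /\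
         forall n : nat, (0 < n)%N -> ~ V (semigroupK n)].
Proof.
tfae.
(* Under (1) the members of V are cyclically regular, so the failures proved above supply the
   exclusions, and the same [collapse_variety] serves here and in the passage from (3) to (1). *)
- move=> H; have [||||||n [n0 Hn]] := collapse_variety hV; last by exists n.
  + by move/H/A_not_cyclically_regular.
  + by move/H/B_not_cyclically_regular.
  + by move/H/Cl_not_cyclically_regular.
  + by move/H/Cr_not_cyclically_regular.
  + by move/H/N3_not_cyclically_regular.
  + by move=> n n0 /H; exact: K_not_cyclically_regular.
- move=> [n [n0 H]].
  have {}H S : V S -> cyclically_regular S.
    by move=> VS; exact: identities_cyclically_regular n0 (H S VS).
  do !split; [move/H/A_not_cyclically_regular|move/H/B_not_cyclically_regular|
    move/H/Cl_not_cyclically_regular|move/H/Cr_not_cyclically_regular|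
    move/H/N3_not_cyclically_regular|move/H/D_not_cyclically_regular|] => //.
  by move=> m m0 /H; exact: K_not_cyclically_regular.
move=> [nA [nB [nCl [nCr [nN [_ nK]]]]]] S VS.
have [n [n0 H]] := collapse_variety hV nA nB nCl nCr nN nK.
exact: identities_cyclically_regular n0 (H S VS).
Qed.
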